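(* Let $s\ge 1$, $G=(\mathbb{Z}/2\mathbb{Z})^s$, and let $(G,\mathcal T,\mathcal Z)$ be a tame decomposition configuration, $\mathcal T=\{T_1,\dots,T_s\}$, $T_i=\langle x_i\rangle$, $\mathcal Z=\{Z_1,\dots,Z_s\}$. Then $(G,\mathcal T,\mathcal Z)$ is realizable over $\mathbb{Q}$ if and only if the associated sign matrix $S_{\mathcal Z}$ is a QR matrix. For $s\le 2$ every tame decomposition configuration for $(\mathbb{Z}/2\mathbb{Z})^s$ is realizable over $\mathbb{Q}$, while for every $s\ge 3$ there exist tame decomposition configurations for $(\mathbb{Z}/2\mathbb{Z})^s$ that are not realizable over $\mathbb{Q}$.
   Context: A (minimal) tame decomposition configuration for $G=(\mathbb{Z}/2\mathbb{Z})^s$ consists of cyclic subgroups $T_1,\dots,T_s$ generating $G$ (necessarily $T_i=\langle x_i\rangle$ of order 2 and $G=T_1\times\cdots\times T_s$) and subgroups $Z_1,\dots,Z_s$ with $T_i\le Z_i$ and $Z_i/T_i$ cyclic. For each $i$ let $z_i$ be the generator of the group $Z_i\cap\prod_{j\ne i}T_j$ (of order $\le 2$), and write $z_i=\prod_j x_j^{a_{ij}}$ with $a_{ij}\in\{0,1\}$, $a_{ii}=0$. The sign matrix $S_{\mathcal Z}=(m_{ij})$ is the $s\times s$ matrix with $m_{ii}=0$ and $m_{ij}=(-1)^{a_{ij}}$ for $i\ne j$. A sign matrix (zero diagonal, off-diagonal entries $\pm1$) $M=(m_{ij})$ is a QR matrix if there are distinct odd primes $p_1,\dots,p_s$ with $m_{ij}=\left(\frac{p_i}{p_j}\right)$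 (Legendre symbol) for all $i\ne j$. Realizable over $\mathbb{Q}$: there exist a tamely ramified Galois extension $K/\mathbb{Q}$ and an isomorphism $\varphi:\operatorname{Gal}(K/\mathbb{Q})\to G$ such that, with $p_1,\dots,p_s$ all the finite primes ramified in $K$ (suitably ordered), for each $i$ some prime $\wp_i$ of $K$ over $p_i$ has $\varphi(T(\wp_i/(p_i)))=T_i$ and $\varphi(Z(\wp_i/(p_i)))=Z_i$ (inertia and decomposition groups). *)

(* Defs.v *)
From HB Require Import structures.
From mathcomp Require Import all_boot all_order all_algebra all_fingroup all_solvable all_field.
Set Implicit Arguments. Unset Strict Implicit. Unset Printing Implicit Defensive.
Import GRing.Theory.

Local Open Scope group_scope.

Definition tame_config (s : nat) (gT : finGroupType) (G : {group gT})
    (T Z : 'I_s -> {group gT}) : Prop :=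
  [/\ 2.-abelem G, #|G| = (2 ^ s)%N,
      <<\bigcup_(i < s) T i>> = G :> {set gT} &
      forall i, [/\ cyclic (T i), T i \subset Z i, Z i \subset G
                  & cyclic (Z i / T i)]].

Definition prod_except (s : nat) (gT : finGroupType) (T : 'I_s -> {group gT})
    (i : 'I_s) : {set gT} := <<\bigcup_(k < s | k != i) T k>>.

Definition zgen (s : nat) (gT : finGroupType) (T Z : 'I_s -> {group gT})
    (i : 'I_s) : gT :=
  let C := Z i :&: prod_except T i in
  odflt 1 [pick x in C | <[x]> == C].

(* a_ij = 1 iff the x_j-coordinate of z_i (w.r.t. G = T_1 x ... x T_s) is
   nontrivial, i.e. iff z_i does not lie in prod_{k<>j} T_k. *)
Definition sign_matrix (s : nat) (gT : finGroupType) (T Z : 'I_s -> {group gT})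
    (i j : 'I_s) : int :=
  if i == j then 0%R
  else if zgen T Z i \notin prod_except T j then (-1)%R else 1%R.

Definition legendre (a p : nat) : int :=
  if p %| a then 0%R
  else if [exists x : 'I_p, (x * x) %% p == a %% p] then 1%R else (-1)%R.

Definition QR_matrix (s : nat) (M : 'I_s -> 'I_s -> int) : Prop :=
  exists p : 'I_s -> nat,
    [/\ injective p, forall i, prime (p i) && odd (p i)
      & forall i j, i != j -> M i j = legendre (p i) (p j)].

Section NumberField.
Variable L : splittingFieldType rat.
Local Open Scope ring_scope.

Definition integral (x : L) : Prop :=
  exists q : {poly int}, q \is monic /\ root (map_poly (fun z : int => (z%:~R)%R) q) x.

Definition prime_ideal (P : L -> Prop) : Prop :=
  (forall x, P x -> integral x) /\
  P 0 /\
  (forall x y, P x -> P y -> P (x + y)) /\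
  (forall a x, integral a -> P x -> P (a * x)) /\
  ~ P 1 /\
  (forall x y, integral x -> integral y -> P (x * y) -> P x \/ P y) /\
  (exists x, P x /\ x <> 0).

Definition lies_over (P : L -> Prop) (p : nat) : Prop :=
  prime_ideal P /\ P (p%:R)%R.

Definition decomp_mem (P : L -> Prop) (g : gal_of {:L}) : Prop :=
  forall x, P (g x) <-> P x.

Definition inertia_mem (P : L -> Prop) (g : gal_of {:L}) : Prop :=
  decomp_mem P g /\ forall x, integral x -> P (g x - x)%R.

(* p ramifies in L iff O_L / p O_L is not reduced *)
Definition ramified (p : nat) : Prop :=
  exists (x : L) (n : nat), [/\ integral x,
     ~ (exists y, integral y /\ x = (p%:R * y)%R)
   & exists y, integral y /\ (x ^+ n = p%:R * y)%R].

(* tamely ramified: p does not divide e(P/p) = #|T(P)| (Galois case) *)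
Definition tamely_ramified : Prop :=
  forall p P, prime p -> lies_over P p ->
    exists I : {set gal_of {:L}},
      (forall g, g \in I <-> (g \in 'Gal({:L} / 1%VS) /\ inertia_mem P g))
      /\ ~~ (p %| #|I|)%N.

End NumberField.

Definition realizable (s : nat) (gT : finGroupType) (G : {group gT})
    (T Z : 'I_s -> {group gT}) : Prop :=
  exists L : splittingFieldType rat,
  [/\ galois 1%VS {:L}, tamely_ramified L &
  exists phi : {morphism 'Gal({:L} / 1%VS) >-> gT},
  isom 'Gal({:L} / 1%VS) G phi /\
  exists p : 'I_s -> nat,
    [/\ injective p, forall i, prime (p i),
        forall q, prime q -> (ramified L q <-> exists i, q = p i)
      & forall i, exists P : L -> Prop, lies_over P (p i) /\
          forall g, g \in 'Gal({:L} / 1%VS) ->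
            (phi g \in T i <-> inertia_mem P g) /\
            (phi g \in Z i <-> decomp_mem P g)]].

(* Main.v *)
Require Import Defs.
From HB Require Import structures.
From mathcomp Require Import boolp classical_sets.
From mathcomp Require Import all_boot all_order all_algebra all_fingroup all_solvable all_field.
From mathcomp Require Import mxabelem.
From mathcomp Require Import ring zify.

(** Write [p* = (-1)^((p-1)/2) p].  A realizing field must be generated by the square
    roots of [p_1*, ..., p_s*]: to each generator [x_j] belongs a quadratic character of
    the Galois group, hence a square root [m_j] of a squarefree integer [d_j]; the primes
    dividing [d_j] ramify, inertia rules out every [p_k] with [k <> j], and tameness at
    [2] forces [d_j = p_j*].
    In a field generated by square roots [m_j] of integers [d_j = 1 mod 4] with squarefree
    product, let [moved g] be the set of the [j] with [g m_j = - m_j], and fix an odd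
    prime [q].  The inertia groups over [q] are given by the condition that [moved g] is
    contained in the set of the [j] with [q | d_j].  Outside that set, [moved g] is empty or
    equal to the set of the [j] for which [d_j] is a nonresidue mod [q] whenever [g] lies
    in a decomposition group; conversely, in the second case [g] acts on the [m_j], and
    hence on all integers, as the [q]-th power map modulo the prime.  By quadratic
    reciprocity [p_j*] is a nonresidue mod [p_i] iff [(p_i / p_j) = -1].
    Taking supports identifies [G] with the subsets of [{1, ..., s}], and [Z_i] with the
    sets that, away from [i], are empty or the support of [z_i]; so the two descriptions
    agree exactly when the sign matrix is the matrix of Legendre symbols. *)

Set Implicit Arguments. Unset Strict Implicit. Unset Printing Implicit Defensive.
Import GRing.Theory Num.Theory.
Local Open Scope ring_scope.

(** * Quadratic reciprocity *)

Lemma sum_sign_reversing (T : finType) (f : T -> int) (h : T -> T) :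
  injective h -> (forall t, f (h t) = - f t) -> \sum_t f t = 0.
Proof.
move=> h_inj fh; apply/eqP; rewrite -eqNr -sumrN [X in _ == X](reindex_inj h_inj).
by apply/eqP/eq_bigr => t _; rewrite fh.
Qed.

Lemma odd_half_predK n : odd n -> n.-1./2.*2 = n.-1.
Proof. by case: n => //= n even_n; rewrite even_halfK. Qed.

Lemma intr_sign_inj (R : nzRingType) :
  (2 : R) != 0 -> {in [:: 0; 1; -1] &, injective (intr : int -> R)}.
Proof.
move=> nz2 a b; have nz1 : (1 : R) != 0 := oner_neq0 R.
rewrite !inE => /or3P[] /eqP-> /or3P[] /eqP-> //= /eqP; rewrite ?mulrNz ?mulr1z ?mulr0z.
- by rewrite eq_sym (negPf nz1).
- by rewrite eq_sym oppr_eq0 (negPf nz1).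
- by rewrite (negPf nz1).
- by rewrite -addr_eq0 (negPf nz2).
- by rewrite oppr_eq0 (negPf nz1).
- by rewrite eq_sym -addr_eq0 (negPf nz2).
Qed.

Definition qchar (F : finFieldType) (a : F) : int :=
  if a == 0 then 0 else if [exists y : F, y ^+ 2 == a] then 1 else -1.

Section QuadraticCharacter.
Variable F : finFieldType.
Hypothesis odd_F : odd #|F|.
Implicit Types a b : F.

Lemma finField_two_neq0 : (2 : F) != 0.
Proof.
apply/negP => two0; have pchar2 : 2 \in [pchar F] by rewrite inE.
move: odd_F (finNzRing_gt1 F); rewrite (card_pprimeChar pchar2) oddX orbF.
by move/eqP->.
Qed.

Lemma qchar_neq0 a : a != 0 -> qchar a = 1 \/ qchar a = -1.
Proof. by rewrite /qchar => /negPf ->; case: ifP; [left | right]. Qed.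

Lemma qchar_eq0 a : (qchar a == 0) = (a == 0).
Proof. by rewrite /qchar; case: ifP => // _; case: ifP. Qed.

Lemma qchar_in_sign a : qchar a \in [:: 0; 1; -1].
Proof. by rewrite /qchar; case: ifP => // _; case: ifP. Qed.

Lemma qchar_sqr a : a != 0 -> qchar a ^+ 2 = 1.
Proof. by case/qchar_neq0=> ->. Qed.

Lemma qchar1P a : reflect (a != 0 /\ exists y : F, y ^+ 2 = a) (qchar a == 1).
Proof.
rewrite /qchar; apply: (iffP eqP) => [|[/negPf-> [y Dy]]].
  case: eqVneq => // nz_a; case: existsP => // -[y /eqP Dy] _.
  by split; last exists y.
by case: existsP => // noy; case: noy; exists y; apply/eqP.
Qed.

Lemma finField_expf_pred_card a : a != 0 -> a ^+ #|F|.-1 = 1.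
Proof.
move=> nz_a; apply: (mulfI nz_a).
by rewrite -exprS prednK ?expf_card ?mulr1 // ltnW ?finNzRing_gt1.
Qed.

Lemma half_pred_card_gt0 : (0 < (#|F|.-1)./2)%N.
Proof.
rewrite -double_gt0 odd_half_predK // -subn1 subn_gt0.
exact: finNzRing_gt1.
Qed.

(* With [a = g ^+ n] for a generator [g] of the units, the hypothesis makes [n] even. *)
Lemma sqrt_of_half_power a :
  a != 0 -> a ^+ (#|F|.-1)./2 = 1 -> exists y : F, y ^+ 2 = a.
Proof.
move=> nz_a a_half; have Ua : a \is a GRing.unit by rewrite unitfE.
have /cyclicP[g Dg] := field_unit_group_cyclic [set: {unit F}]%G.
have [n Dn] : exists n, FinRing.unit F Ua = (g ^+ n)%g.
  by apply/cycleP; rewrite -Dg inE.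
have Da : a = FinRing.uval g ^+ n by rewrite -FinRing.val_unitX /= -Dn.
have : (#[g]%g %| n * (#|F|.-1)./2)%N.
  rewrite order_dvdn; apply/eqP/val_inj.
  by rewrite FinRing.val_unitX /= exprM -Da a_half.
rewrite orderE -Dg card_finField_unit -[X in (X %| _)%N]odd_half_predK // -mul2n.
rewrite dvdn_pmul2r ?half_pred_card_gt0 // dvdn2 => even_n.
by exists (FinRing.uval g ^+ n./2); rewrite -exprM muln2 even_halfK.
Qed.

Lemma Euler_criterion a : (qchar a)%:~R = a ^+ (#|F|.-1)./2.
Proof.
rewrite /qchar; have [-> | nz_a] := eqVneq a 0.
  by rewrite expr0n gtn_eqF // half_pred_card_gt0.
case: ifP => [/existsP[y /eqP Dy] | nosqrt].
  rewrite -Dy -exprM mul2n odd_half_predK // finField_expf_pred_card //.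
  by apply: contraNneq nz_a => y0; rewrite -Dy y0 expr0n.
have : (a ^+ (#|F|.-1)./2) ^+ 2 == 1.
  by rewrite -exprM muln2 odd_half_predK // finField_expf_pred_card.
rewrite sqrf_eq1 => /orP[/eqP a_half | /eqP -> //].
have [y Dy] := sqrt_of_half_power nz_a a_half.
by case/existsP: nosqrt; exists y; apply/eqP.
Qed.

Lemma qcharM : {morph @qchar F : a b / a * b}.
Proof.
move=> a b; apply: (intr_sign_inj finField_two_neq0); first exact: qchar_in_sign.
  move: (qchar_in_sign a) (qchar_in_sign b).
  by rewrite !inE => /or3P[] /eqP-> /or3P[] /eqP->.
by rewrite rmorphM /= !Euler_criterion exprMn.
Qed.

Lemma qchar1 : qchar (1 : F) = 1.
Proof. by apply/eqP/qchar1P; split; [exact: oner_neq0 | exists 1; rewrite expr1n]. Qed.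

Lemma qcharX n : {morph @qchar F : a / a ^+ n}.
Proof. by elim: n => [|n IHn] a; rewrite ?qchar1 // !exprS qcharM IHn. Qed.

Lemma qcharN1 : qchar (-1 : F) = (-1) ^+ (#|F|.-1)./2.
Proof.
apply: (intr_sign_inj finField_two_neq0); first exact: qchar_in_sign.
  by rewrite -signr_odd; case: odd.
by rewrite Euler_criterion rmorphXn /= rmorphN1.
Qed.

(* Otherwise squaring would be a permutation of [F], although [1] and [-1] have the same square. *)
Lemma nonsquare_exists : exists2 a : F, a != 0 & qchar a = -1.
Proof.
have [/forallP sq | /forallPn[a nosqrt]] := boolP [forall a : F, exists y : F, y ^+ 2 == a].
  have [r rK] := fin_all_exists (fun a => existsP (sq a)).
  have /canF_sym/can_inj sqr_inj : cancel r (fun y => y ^+ 2) by move=> a; apply/eqP.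
  have /eqP : (1 : F) = -1 by apply: sqr_inj; rewrite sqrrN.
  by rewrite -addr_eq0 (negPf finField_two_neq0).
have nz_a : a != 0 by apply: contraNneq nosqrt => ->; apply/existsP; exists 0; rewrite expr0n.
by exists a; rewrite // /qchar (negPf nz_a) (negPf nosqrt).
Qed.

Lemma sum_qchar : \sum_(a : F) qchar a = 0.
Proof.
have [b nz_b chi_b] := nonsquare_exists.
apply: (sum_sign_reversing (mulfI nz_b)) => a.
by rewrite qcharM chi_b mulN1r.
Qed.

End QuadraticCharacter.

Lemma odd_card_Fp p : prime p -> odd p -> odd #|'F_p|.
Proof. by move=> pr_p odd_p; rewrite card_Fp. Qed.

Lemma Fp_natr_prime_neq0 (p q : nat) :
  prime p -> prime q -> p != q -> (q%:R : 'F_p) != 0.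
Proof. by move=> pr_p pr_q neq_pq; rewrite -(dvdn_pcharf (pchar_Fp pr_p)) dvdn_prime2. Qed.

Lemma Euler_criterion_pchar (R : nzRingType) (p : nat) (a : int) :
  p \in [pchar R] -> odd p ->
  a%:~R ^+ (p.-1)./2 = (qchar (a%:~R : 'F_p))%:~R :> R.
Proof.
move=> pcharR odd_p; have pr_p := pcharf_prime pcharR.
have := Euler_criterion (odd_card_Fp pr_p odd_p) a%:~R; rewrite card_Fp // => /esym/eqP.
rewrite -!rmorphXn -subr_eq0 -rmorphB /= -(dvdz_pcharf (pchar_Fp pr_p)).
by rewrite (dvdz_pcharf pcharR) rmorphB /= subr_eq0 => /eqP.
Qed.

Definition qstar (q : nat) : int := (-1) ^+ (q.-1)./2 * q%:Z.

Section GaussSum.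
Variable q : nat.
Hypotheses (pr_q : prime q) (odd_q : odd q).
Variables (K : fieldType) (w : K).
Hypotheses (w_unity : w ^+ q = 1) (w_neq1 : w != 1).
Implicit Types a b c : 'F_q.

Definition add_char a : K := w ^+ a.

Definition gauss_sum : K := \sum_a (qchar a)%:~R * add_char a.

Let odd_Fq : odd #|'F_q| := odd_card_Fp pr_q odd_q.

Lemma add_char_natr (n : nat) : add_char n%:R = w ^+ n.
Proof. by rewrite /add_char val_Fp_nat // expr_mod. Qed.

Lemma add_charD a b : add_char (a + b) = add_char a * add_char b.
Proof. by rewrite -(natr_Zp a) -(natr_Zp b) -natrD !add_char_natr exprD. Qed.

Lemma sum_add_char c : \sum_a add_char (a * c) = if c == 0 then q%:R else 0.
Proof.
have [-> | nz_c] := eqVneq c 0.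
  rewrite (eq_bigr (fun=> 1)) ?sumr_const ?card_Fp // => a _.
  by rewrite mulr0 (add_char_natr 0) expr0.
rewrite (reindex_inj (divIf nz_c)) /= (eq_bigr add_char) => [|a _]; last first.
  by rewrite divfK.
have /eqP : (\sum_a add_char a) * (add_char 1 - 1) = 0.
  rewrite mulrBr mulr1 mulr_suml [X in _ - X](reindex_inj (addIr 1)) /=.
  by apply/eqP; rewrite subr_eq0; apply/eqP/eq_bigr => a _; rewrite add_charD.
by rewrite mulf_eq0 subr_eq0 (add_char_natr 1) (negPf w_neq1) orbF => /eqP.
Qed.

Lemma sqr_gauss_sum : gauss_sum ^+ 2 = (qstar q)%:~R.
Proof.
have -> : gauss_sum ^+ 2 = \sum_(a | a != 0) \sum_c (qchar c)%:~R * add_char (a * (1 + c)).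
  rewrite expr2 {1}/gauss_sum mulr_suml (bigD1 0) //= {1}/qchar eqxx mulr0z !mul0r add0r.
  apply: eq_bigr => a nz_a; rewrite mulr_sumr (reindex_inj (mulfI nz_a)) /=.
  apply: eq_bigr => c _; rewrite qcharM // mulrACA -rmorphM /= [qchar a * (_ * _)]mulrA.
  by rewrite -expr2 qchar_sqr // mul1r -add_charD mulrDr mulr1.
rewrite exchange_big /= (eq_bigr (fun c =>
   (qchar c)%:~R * (if 1 + c == 0 then q%:R else 0) - (qchar c)%:~R)); last first.
  move=> c _; rewrite -sum_add_char (bigD1 0 (P := predT)) //= mul0r (add_char_natr 0) mulrDr.
  by rewrite mulr1 addrAC subrr add0r mulr_sumr.
rewrite sumrB -[X in _ - X]rmorph_sum /= sum_qchar // subr0.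
rewrite (bigD1 (-1)) //= subrr eqxx big1 => [|c]; last first.
  by rewrite -subr_eq0 opprK addrC => /negPf ->; rewrite mulr0.
by rewrite addr0 qcharN1 // card_Fp // /qstar rmorphM.
Qed.

Variable p : nat.
Hypotheses (pcharK : p \in [pchar K]) (odd_p : odd p) (neq_pq : p != q).

Let pr_p : prime p := pcharf_prime pcharK.

Lemma gauss_sum_Frobenius : gauss_sum ^+ p = (qchar (p%:R : 'F_q))%:~R * gauss_sum.
Proof.
have nz_p : (p%:R : 'F_q) != 0 by rewrite Fp_natr_prime_neq0 // eq_sym.
rewrite -(pFrobenius_autE pcharK) rmorph_sum /= mulr_sumr [RHS](reindex_inj (mulfI nz_p)) /=.
apply: eq_bigr => a _; rewrite rmorphM /= rmorph_int qcharM // mulrA -rmorphM /=.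
rewrite [X in _ = X%:~R * _]mulrA -expr2 qchar_sqr // mul1r; congr (_ * _).
by rewrite pFrobenius_autE -exprM -add_char_natr natrM natr_Zp mulrC.
Qed.

Lemma gauss_sum_neq0 : gauss_sum != 0.
Proof.
rewrite -sqrf_eq0 sqr_gauss_sum rmorphM rmorphXn /= rmorphN1 mulf_neq0 ?signr_eq0 //.
by rewrite -(dvdn_pcharf pcharK) dvdn_prime2.
Qed.

Lemma gauss_sum_reciprocity : qchar ((qstar q)%:~R : 'F_p) = qchar (p%:R : 'F_q).
Proof.
have nz2 : (2 : K) != 0 by rewrite -(dvdn_pcharf pcharK) gtnNdvd // odd_prime_gt2.
apply: (intr_sign_inj nz2); rewrite ?qchar_in_sign //.
apply: (mulIf gauss_sum_neq0); rewrite -gauss_sum_Frobenius.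
rewrite -Euler_criterion_pchar // -sqr_gauss_sum -exprM mul2n odd_half_predK //.
by rewrite -exprSr prednK // prime_gt0.
Qed.

End GaussSum.

(* The field with [p ^ (q - 1)] elements works, by Fermat's little theorem. *)
Lemma pchar_unity_root_exists (p q : nat) : prime p -> prime q -> p != q ->
  exists K : finFieldType, p \in [pchar K] /\ exists2 w : K, w ^+ q = 1 & w != 1.
Proof.
move=> pr_p pr_q neq_pq.
have q1_gt0 : (0 < q.-1)%N by rewrite -subn1 subn_gt0 prime_gt1.
have [K pcharK cardK] := pPrimePowerField pr_p q1_gt0.
have q_dvd : (q %| #|[set: {unit K}]|)%N.
  rewrite card_finField_unit cardK -subn1 -eqn_mod_dvd ?expn_gt0 ?prime_gt0 //.
  rewrite -(totient_prime pr_q); apply/eqP/Euler_exp_totient.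
  by rewrite coprime_sym prime_coprime // dvdn_prime2 // eq_sym.
have [u _ ou] := Cauchy pr_q q_dvd; exists K; split=> //; exists (FinRing.uval u).
  by rewrite -FinRing.val_unitX -ou expg_order.
apply: contraL (prime_gt1 pr_q) => /eqP u1.
by rewrite -ou (_ : u = 1%g) ?order1 //; apply: val_inj.
Qed.

Theorem quadratic_reciprocity (p q : nat) :
  prime p -> odd p -> prime q -> odd q -> p != q ->
  qchar ((qstar q)%:~R : 'F_p) = qchar (p%:R : 'F_q).
Proof.
move=> pr_p odd_p pr_q odd_q neq_pq.
have [K [pcharK [w w_unity w_neq1]]] := pchar_unity_root_exists pr_p pr_q neq_pq.
exact: (gauss_sum_reciprocity pr_q odd_q w_unity w_neq1 pcharK).
Qed.

Lemma legendreE a p : prime p -> legendre a p = qchar (a%:R : 'F_p).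
Proof.
move=> pr_p; have pcharFp := pchar_Fp pr_p.
rewrite /legendre /qchar -(dvdn_pcharf pcharFp); case: ifP => // _.
congr (if _ then _ else _); apply/existsP/existsP=> [[x /eqP Dx] | [y /eqP Dy]].
  exists (x : nat)%:R; apply/eqP; apply: val_inj.
  by rewrite -natrX /= !val_Fp_nat // -mulnn.
have lt_y : (y < p)%N by rewrite -[X in (_ < X)%N](Fp_cast pr_p) ltn_ord.
exists (Ordinal lt_y); apply/eqP; rewrite /= -!(val_Fp_nat pr_p).
by congr val; rewrite natrM -expr2 natr_Zp.
Qed.

Lemma qchar_qstar (p q : nat) :
  prime p -> odd p -> prime q -> odd q -> p != q ->
  qchar ((qstar q)%:~R : 'F_p) = legendre p q.
Proof. by move=> *; rewrite legendreE // quadratic_reciprocity. Qed.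

Lemma legendre_sym (p q : nat) : prime p -> odd p -> prime q -> odd q -> p != q ->
  legendre p q = (-1) ^+ ((p.-1)./2 * (q.-1)./2) * legendre q p.
Proof.
move=> pr_p odd_p pr_q odd_q neq_pq.
rewrite -(qchar_qstar pr_p odd_p pr_q odd_q neq_pq) (legendreE q pr_p) /qstar.
have odd_Fp := odd_card_Fp pr_p odd_p.
by rewrite rmorphM /= qcharM // rmorphXn /= rmorphN1 qcharX // qcharN1 // card_Fp // exprM.
Qed.

Lemma legendre_cases (p q : nat) : prime p -> prime q -> p != q ->
  legendre p q = 1 \/ legendre p q = -1.
Proof.
move=> pr_p pr_q neq_pq; rewrite legendreE //.
by apply/qchar_neq0/Fp_natr_prime_neq0; rewrite // eq_sym.
Qed.

Lemma legendre_symmetric (p q : nat) : prime p -> odd p -> prime q -> odd q -> p != q ->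
  (legendre p q == legendre q p) = ~~ (odd (p.-1)./2 && odd (q.-1)./2).
Proof.
move=> pr_p odd_p pr_q odd_q neq_pq; rewrite legendre_sym // -signr_odd oddM.
have neq_qp : q != p by rewrite eq_sym.
by case: (legendre_cases pr_q pr_p neq_qp) => ->; case: (_ && _).
Qed.

Lemma legendre_has (a p : nat) : legendre a p =
  if (p %| a)%N then 0 else
  if has (fun x => (x * x) %% p == a %% p)%N (iota 0 p) then 1 else -1.
Proof.
rewrite /legendre -val_enum_ord has_map; case: ifP => // _; congr (if _ then _ else _).
by apply/existsP/hasP=> [[x sq_x] | [x _ sq_x]]; exists x; rewrite // mem_enum.
Qed.

(** * Integral elements and prime ideals *)

Section NumberFieldIntegers.
Variable L : splittingFieldType rat.
Implicit Types (x y : L) (g h : gal_of {:L}) (k : int).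

Lemma integralP x : integral x <-> integralOver (intr : int -> L) x.
Proof. by split=> [[q [mq rq]] | [q mq rq]]; exists q. Qed.

Lemma integral_intr k : integral (k%:~R : L).
Proof. by apply/integralP; exact: (integral_id (intr : {rmorphism int -> L})). Qed.

Lemma integral0 : integral (0 : L). Proof. exact: (integral_intr 0). Qed.

Lemma integral1 : integral (1 : L). Proof. exact: (integral_intr 1). Qed.

Lemma integral_natr n : integral (n%:R : L). Proof. exact: (integral_intr n%:Z). Qed.

Lemma integralD x y : integral x -> integral y -> integral (x + y).
Proof. by move=> /integralP ix /integralP iy; apply/integralP; exact: integral_add. Qed.

Lemma integralN x : integral x -> integral (- x).
Proof. by move=> /integralP ix; apply/integralP; exact: integral_opp. Qed.

Lemma integralB x y : integral x -> integral y -> integral (x - y).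
Proof. by move=> ix /integralN; exact: integralD. Qed.

Lemma integralM x y : integral x -> integral y -> integral (x * y).
Proof. by move=> /integralP ix /integralP iy; apply/integralP; exact: integral_mul. Qed.

Lemma integralX x n : integral x -> integral (x ^+ n).
Proof.
by move=> ix; elim: n => [|n IHn]; [exact: integral1 | rewrite exprS; exact: integralM].
Qed.

Lemma integral_sum (I : Type) (r : seq I) (Q : pred I) (F : I -> L) :
  (forall i, Q i -> integral (F i)) -> integral (\sum_(i <- r | Q i) F i).
Proof. by move=> iF; elim/big_ind: _; [exact: integral0 | exact: integralD |]. Qed.

Lemma integral_prod (I : Type) (r : seq I) (Q : pred I) (F : I -> L) :
  (forall i, Q i -> integral (F i)) -> integral (\prod_(i <- r | Q i) F i).
Proof. by move=> iF; elim/big_ind: _; [exact: integral1 | exact: integralM |]. Qed.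

Lemma integral_sqrt x k : x ^+ 2 = k%:~R -> integral x.
Proof.
move=> x2; exists ('X^2 - k%:P); split; first exact: monicXnsubC.
by rewrite rmorphB /= map_polyXn map_polyC /= /root !hornerE x2 subrr.
Qed.

Lemma integral_gal g x : integral x -> integral (g x).
Proof.
case=> q [mq /rootP rq]; exists q; split=> //; apply/rootP.
have := congr1 g rq; rewrite rmorph0 -horner_map /= => rgq.
rewrite -[RHS]rgq; congr (_.[_]); apply/polyP => i.
by rewrite !coef_map /= rmorph_int.
Qed.

Lemma integral_rat x : integral x -> x \in 1%VS -> exists k, x = k%:~R.
Proof.
case=> q [mq rq] /vlineP[r Dx].
have map_int (R : unitRingType) (f : {rmorphism rat -> R}) :
    map_poly f (map_poly intr q) = map_poly intr q.
  by rewrite -map_poly_comp; apply: eq_map_poly => k /=; rewrite rmorph_int.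
have /intrP[k Dk] : (ratr r : algC) \is a Num.int.
  apply: Cint_rat_Aint; first exact: Crat_rat.
  apply: (@root_monic_Aint (map_poly intr q)).
  - move: rq; rewrite Dx -[_%:A]/(in_alg L r) -(map_int _ (in_alg L)).
    by rewrite fmorph_root -(map_int algC ratr) fmorph_root.
  - by rewrite monic_map.
  by apply/polyOverP => i; rewrite coef_map /= intr_int.
exists k; rewrite Dx.
have -> : r = k%:~R.
  by apply: (fmorph_inj (ratr : {rmorphism rat -> algC})); rewrite /= Dk rmorph_int.
by rewrite -[LHS]/(in_alg L _) rmorph_int.
Qed.

Lemma intrL_inj : injective (intr : int -> L).
Proof.
move=> k l /= eq_kl; have /(fmorph_inj (in_alg L)) /eqP : in_alg L k%:~R = in_alg L l%:~R.
  by rewrite !rmorph_int.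
by rewrite eqr_int => /eqP.
Qed.

Lemma intrL_eq0 k : (k%:~R == 0 :> L) = (k == 0).
Proof. by rewrite -(inj_eq intrL_inj). Qed.

Lemma natrL_eq0 n : (n%:R == 0 :> L) = (n == 0)%N.
Proof. exact: (intrL_eq0 n%:Z). Qed.

Lemma natrL_prime_neq0 n : prime n -> (n%:R : L) != 0.
Proof. by move=> pr_n; rewrite natrL_eq0 -lt0n prime_gt0. Qed.

Lemma mem_Gal1 g : g \in 'Gal({:L} / 1)%g.
Proof.
rewrite gal_kHom ?sub1v //; apply/kAHomP => a /vlineP[k ->].
by rewrite linearZ /= rmorph1.
Qed.

Lemma galMx g h x : (g * h)%g x = h (g x).
Proof. by rewrite galM ?memvf. Qed.

Lemma gal_sqrt_intr g x k : x ^+ 2 = k%:~R -> g x = x \/ g x = - x.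
Proof.
move=> x2; have : g x ^+ 2 == x ^+ 2 by rewrite -rmorphXn /= x2 rmorph_int.
by rewrite eqf_sqr => /orP[] /eqP; [left | right].
Qed.

Lemma gal_generators_faithful (rs : seq L) g :
  <<1 & rs>>%VS = fullv -> {in rs, forall x, g x = x} -> g = 1%g.
Proof.
move=> gen_rs fix_rs; apply/eqP/gal_eqP => x _; rewrite gal_id.
have: (<<1 & rs>> <= fixedField [set g])%VS.
  apply/Fadjoin_seqP; split; first exact: sub1v.
  by move=> y rs_y; apply/fixedFieldP; rewrite ?memvf // => h /set1P->; exact: fix_rs.
rewrite gen_rs => /subvP/(_ x (memvf _)) /(fixedFieldP (memvf _)); apply.
by rewrite inE.
Qed.

Hypothesis galL : galois 1 {:L}.

Lemma gal_fixed_rat x : (forall g, g x = x) -> x \in 1%VS.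
Proof. by move=> fx; rewrite -(galois_fixedField galL); apply/fixedFieldP; rewrite ?memvf. Qed.

Lemma gal_fixed_int x : integral x -> (forall g, g x = x) -> exists k, x = k%:~R.
Proof. by move=> ix /gal_fixed_rat; exact: integral_rat. Qed.

Lemma integral_trace x : integral x -> exists k, \sum_(g : gal_of {:L}) g x = k%:~R.
Proof.
move=> ix; apply: gal_fixed_int => [|h].
  by apply: integral_sum => g _; exact: integral_gal.
rewrite rmorph_sum [RHS](reindex_inj (mulIg h)) /=.
by apply: eq_bigr => g _; rewrite galMx.
Qed.

End NumberFieldIntegers.

Section PrimeIdeal.
Variables (L : splittingFieldType rat) (P : L -> Prop) (p : nat).
Hypotheses (pr_p : prime p) (Pp : lies_over P p).
Implicit Types (a x y : L) (k : int).

Lemma ideal_integral x : P x -> integral x.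
Proof. by case: Pp => [[iP _] _]; exact: iP. Qed.

Lemma ideal0 : P 0.
Proof. by case: Pp => [[_ []]]. Qed.

Lemma idealD x y : P x -> P y -> P (x + y).
Proof. by case: Pp => [[_ [_ [PD _]]] _]; exact: PD. Qed.

Lemma ideal_mull a x : integral a -> P x -> P (a * x).
Proof. by case: Pp => [[_ [_ [_ [PM _]]]] _]; exact: PM. Qed.

Lemma ideal_mulr a x : integral a -> P x -> P (x * a).
Proof. by rewrite mulrC; exact: ideal_mull. Qed.

Lemma ideal_proper : ~ P 1.
Proof. by case: Pp => [[_ [_ [_ [_ []]]]]]. Qed.

Lemma ideal_prime x y : integral x -> integral y -> P (x * y) -> P x \/ P y.
Proof. by case: Pp => [[_ [_ [_ [_ [_ [Ppr _]]]]]] _]; exact: Ppr. Qed.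

Lemma idealN x : P x -> P (- x).
Proof. by rewrite -mulN1r; apply: ideal_mull; exact: (integral_intr _ (-1)). Qed.

Lemma idealB x y : P x -> P y -> P (x - y).
Proof. by move=> Px Py; apply: idealD => //; exact: idealN. Qed.

Lemma ideal_sum (I : Type) (r : seq I) (Q : pred I) (F : I -> L) :
  (forall i, Q i -> P (F i)) -> P (\sum_(i <- r | Q i) F i).
Proof. by move=> PF; elim/big_ind: _; [exact: ideal0 | exact: idealD |]. Qed.

Lemma ideal_of_exp x n : integral x -> P (x ^+ n) -> P x.
Proof.
move=> ix; elim: n => [/ideal_proper // | n IHn].
by rewrite exprS => /ideal_prime[] //; exact: integralX.
Qed.

Lemma ideal_exp x n : P x -> P (x ^+ n.+1).
Proof.
by move=> Px; rewrite exprS; apply: ideal_mulr => //; apply: integralX; exact: ideal_integral.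
Qed.

Lemma ideal_intr k : P k%:~R <-> (p%:Z %| k)%Z.
Proof.
have [_ PpL] := Pp; split=> [Pk | /dvdzP[l ->]]; last first.
  by rewrite rmorphM; apply: ideal_mull => //; exact: integral_intr.
apply: contraT => Npk; have : coprimez p%:Z k by rewrite coprimezE /= prime_coprime.
case/coprimezP=> -[u v] /= Duv; case: ideal_proper.
rewrite -[1](mulr1z) -Duv rmorphD !rmorphM /=.
by apply: idealD; apply: ideal_mull => //; exact: integral_intr.
Qed.

Lemma ideal_cancel_intr k x : ~~ (p%:Z %| k)%Z -> integral x -> P (k%:~R * x) -> P x.
Proof.
move=> Nk ix /ideal_prime[] //; first exact: integral_intr.
by move/ideal_intr => pk; rewrite pk in Nk.
Qed.

Lemma ideal_of_double x : odd p -> integral x -> P (x *+ 2) -> P x.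
Proof.
move=> odd_p ix; rewrite -mulr_natl; apply: (@ideal_cancel_intr 2%:Z) => //.
by rewrite dvdzE /= gtnNdvd // odd_prime_gt2.
Qed.

Lemma ideal_exprD_prime x y :
  integral x -> integral y -> P ((x + y) ^+ p - (x ^+ p + y ^+ p)).
Proof.
move=> ix iy; have p_gt0 := prime_gt0 pr_p.
rewrite exprDn (bigD1 ord0) //= (bigD1 ord_max) /= -?lt0n // subn0 subnn bin0 binn.
rewrite !expr0 mulr1 mul1r addrA [_ + \sum_(_ < _ | _) _]addrC addrK.
apply: ideal_sum => i /andP[i0 ip].
have bin_p : (p %| 'C(p, i))%N.
  rewrite prime_dvd_bin // lt0n i0 ltn_neqAle ip.
  by rewrite -ltnS ltn_ord.
rewrite -mulr_natr; apply: ideal_mull; last exact/(ideal_intr 'C(p, i)%:Z).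
by apply: integralM; exact: integralX.
Qed.

Lemma ideal_intr_Frobenius k : P (k%:~R ^+ p - k%:~R).
Proof.
rewrite -rmorphXn -rmorphB /=; apply/ideal_intr.
rewrite (dvdz_pcharf (pchar_Fp pr_p)) rmorphB rmorphXn /=.
by rewrite -[X in _ ^+ X](card_Fp pr_p) expf_card subrr.
Qed.

Lemma decomp_mem_of_stable (g : gal_of {:L}) :
  (forall x, P x -> P (g x)) -> decomp_mem P g.
Proof.
move=> Pg x; split=> [Pgx|]; last exact: Pg.
have PgX n y : P y -> P ((g ^+ n)%g y).
  by elim: n y => [|n IHn] y Py; rewrite ?expg0 ?gal_id // expgS galMx; apply/IHn/Pg.
rewrite -[x](gal_id {:L}) -(mulgV g) galMx invg_expg.
exact: PgX.
Qed.

Lemma decomp_mem_of_congr (g : gal_of {:L}) n :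
  (forall x, integral x -> P (g x - x ^+ n.+1)) -> decomp_mem P g.
Proof.
move=> gP; apply: decomp_mem_of_stable => x Px; rewrite -[g x](subrK (x ^+ n.+1)).
by apply: idealD; [apply: gP; exact: ideal_integral | exact: ideal_exp].
Qed.

End PrimeIdeal.

Section PrimeOver.
Local Open Scope classical_set_scope.
Variables (L : splittingFieldType rat) (p : nat).
Hypothesis pr_p : prime p.
Implicit Types (A B : set L) (F : set (set L)).

Definition proper_ideal_over A :=
  [/\ A `<=` @integral L, A p%:R, forall x y, A x -> A y -> A (x + y),
      forall a x, integral a -> A x -> A (a * x) & ~ A 1].

Lemma proper_ideal_over_bigcup F :
  F !=set0 -> F `<=` proper_ideal_over -> total_on F classical_sets.subset ->
  proper_ideal_over (\bigcup_(A in F) A).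
Proof.
move=> [A0 FA0] idF totF; split.
- by move=> y [A FA Ay]; have [iA _ _ _ _] := idF A FA; exact: iA.
- by exists A0 => //; have [] := idF A0 FA0.
- have addF A B x y : F A -> F B -> A `<=` B -> A x -> B y -> (\bigcup_(A in F) A) (x + y).
    by move=> FA FB AB /AB Bx By; exists B => //; have [_ _ BD _ _] := idF B FB; exact: BD.
  move=> x y [A FA Ax] [B FB By]; have [AB | BA] := totF _ _ FA FB.
    exact: (addF A B).
  by rewrite addrC; exact: (addF B A).
- move=> a x ia [A FA Ax]; exists A => //.
  by have [_ _ _ AM _] := idF A FA; exact: AM.
- by case=> A FA A1; have [_ _ _ _] := idF A FA.
Qed.

Lemma proper_ideal_over_principal :
  proper_ideal_over [set x | exists2 y, integral y & x = p%:R * y].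
Proof.
have nz_p := natrL_prime_neq0 L pr_p.
split=> [x [y iy ->] | | x y [u iu ->] [v iv ->] | a x ia [y iy ->] | [y iy D1]].
- by apply: integralM => //; exact: integral_natr.
- by exists 1; rewrite ?mulr1 //; exact: integral1.
- by exists (u + v); rewrite ?mulrDr //; exact: integralD.
- by exists (a * y); rewrite 1?mulrCA //; exact: integralM.
have : y \in 1%VS.
  rewrite (_ : y = p%:R^-1) ?(rpredV, rpred_nat) //.
  by apply: (mulfI nz_p); rewrite -D1 divff.
case/(integral_rat iy)=> k Dk; have : (1 : int) = p%:Z * k.
  by apply: (@intrL_inj L); rewrite rmorphM /= -Dk -D1.
move/(congr1 absz); rewrite abszM /= => /esym/eqP; rewrite muln_eq1 => /andP[/eqP p1 _].
by move: pr_p; rewrite p1.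
Qed.

Lemma proper_ideal_over_adjoin A x : proper_ideal_over A -> integral x ->
  ~ (exists a b, [/\ A a, integral b & 1 = a + b * x]) ->
  proper_ideal_over [set z | exists a b, [/\ A a, integral b & z = a + b * x]].
Proof.
move=> [iA Ap AD AM _] ix no1; split=> //.
- by move=> z [a [b [Aa ib ->]]]; apply: integralD; [exact: iA | exact: integralM].
- by exists p%:R, 0; rewrite mul0r addr0; split=> //; exact: integral0.
- move=> u v [a [b [Aa ib ->]]] [a' [b' [Aa' ib' ->]]]; exists (a + a'), (b + b').
  by split; [exact: AD | exact: integralD | ring].
- move=> c u ic [a [b [Aa ib ->]]]; exists (c * a), (c * b).
  by split; [exact: AM | exact: integralM | ring].
Qed.

Lemma maximal_proper_ideal_over_prime A :
  proper_ideal_over A -> (forall B, A `<` B -> ~ proper_ideal_over B) -> lies_over A p.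
Proof.
move=> idA maxA; have [iA Ap AD AM A1] := idA.
have A0 : A 0 by rewrite -(mul0r p%:R); apply: AM => //; exact: integral0.
split=> //; do ![split=> //]; last first.
  by exists p%:R; split=> //; apply/eqP; exact: natrL_prime_neq0.
move=> x y ix iy Axy; have [Ax | nAx] := pselect (A x); [by left | right].
have [a [b [Aa ib D1]]] : exists a b, [/\ A a, integral b & 1 = a + b * x].
  apply: contrapT => /(proper_ideal_over_adjoin idA ix); apply: maxA.
  split=> [z Az | BA]; first by exists z, 0; rewrite mul0r addr0; split=> //; exact: integral0.
  by apply/nAx/BA; exists 0, 1; rewrite mul1r add0r; split=> //; exact: integral1.
rewrite -[y]mul1r D1 mulrDl -mulrA; apply: AD; last exact: AM.
by rewrite mulrC; exact: AM.
Qed.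

Lemma prime_over_exists : exists P : L -> Prop, lies_over P p.
Proof.
(* The empty set is admitted because [Zorn_bigcup] ranges over the empty chain too. *)
pose Q A := A = classical_sets.set0 \/ proper_ideal_over A.
have [|A [QA maxA]] := @Zorn_bigcup _ Q.
  move=> F FQ totF; have [noA | /existsPNP[A FA nzA]] :=
    pselect (forall A, F A -> A = classical_sets.set0).
    by left; rewrite -classical_sets.subset0 => z [A /noA ->].
  pose F' := F `&` proper_ideal_over; right.
  rewrite (_ : \bigcup_(B in F) B = \bigcup_(B in F') B).
    apply: proper_ideal_over_bigcup => [|B [] //|B C [FB _] [FC _]]; last exact: totF.
    by exists A; split=> //; case: (FQ A FA).
  apply/seteqP; split=> z [B FB Bz]; exists B => //; last by case: FB.
  by split=> //; case: (FQ B FB) => // B0; rewrite B0 in Bz.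
exists A; case: QA => [A0 | idA].
  case: (maxA _ _ (or_intror proper_ideal_over_principal)).
  rewrite A0; split=> [z [] // | /(_ 0)[]].
  by exists 0; rewrite ?mulr0 //; exact: integral0.
by apply: maximal_proper_ideal_over_prime => // B AB idB; apply: (maxA B AB); right.
Qed.

End PrimeOver.

(** * Ramification *)

Definition squarefree (d : int) : Prop :=
  forall q : nat, prime q -> ~~ ((q%:Z ^+ 2)%R %| d)%Z.

Lemma squarefree_neq0 d : squarefree d -> d != 0.
Proof. by move=> /(_ 2 isT); apply: contraNneq => ->; exact: dvdz0. Qed.

Lemma squarefree_dvd d e : (e %| d)%Z -> squarefree d -> squarefree e.
Proof. by move=> e_d sq_d q /sq_d; apply: contra => /dvdz_trans; apply. Qed.

Lemma squarefree_dvd_sqr d n : squarefree d -> (d %| n ^+ 2)%Z -> (d %| n)%Z.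
Proof.
move=> sq_d; have d_gt0 : (0 < `|d|)%N by rewrite absz_gt0 squarefree_neq0.
rewrite !dvdzE abszX /= => d_n2; apply/dvdn_partP=> // q.
rewrite mem_primes => /and3P[pr_q _ q_d].
have q_n : (q %| `|n|)%N by have := dvdn_trans q_d d_n2; rewrite Euclid_dvdX // => /andP[].
apply: dvdn_trans q_n; rewrite p_part -[X in (_ %| X)%N]expn1 dvdn_Pexp2l ?prime_gt1 //.
rewrite leqNgt -pfactor_dvdn //.
by have := sq_d q pr_q; rewrite dvdzE abszX.
Qed.

Lemma squarefree_sqr n : squarefree (n ^+ 2) -> `|n|%N = 1%N.
Proof.
move=> sq_n; have := squarefree_neq0 sq_n; rewrite sqrf_eq0 -absz_gt0 => n_gt0.
have := squarefree_dvd_sqr sq_n (dvdzz _).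
rewrite dvdzE abszX -[X in (_ %| X)%N]muln1 -mulnn dvdn_pmul2l // dvdn1.
by move/eqP.
Qed.

Section Ramification.
Variable L : splittingFieldType rat.
Implicit Types (m x y : L) (d k : int) (q : nat).

Lemma integral_half_even y k : integral y -> 2 * y = k%:~R -> (2%:Z %| k)%Z.
Proof.
move=> iy Dy; have nz2 : (2 : L) != 0 by rewrite natrL_eq0.
have [|c Dc] := integral_rat iy.
  by rewrite (_ : y = k%:~R / 2) ?(rpred_div, rpred_int, rpred_nat) // -Dy mulrC mulKf.
by apply/dvdzP; exists c; apply: (@intrL_inj L); rewrite rmorphM /= mulrC -Dc Dy.
Qed.

Lemma ramified_sqrt m d q : m ^+ 2 = d%:~R ->
  (q%:Z %| d)%Z -> ~~ ((q%:Z ^+ 2)%R %| d)%Z -> ramified L q.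
Proof.
move=> m2 /[dup] q_d /dvdzP[k Dk] q2'd.
have nz_q : (q%:R : L) != 0.
  by rewrite natrL_eq0; apply: contraNneq q2'd => q0; rewrite Dk q0 !mulr0 dvdz0.
exists m, 2; split; first exact: integral_sqrt m2.
  case=> y [iy Dm]; have [|c Dc] := integral_rat (integralX 2 iy).
    have -> : y ^+ 2 = d%:~R / q%:R ^+ 2 by rewrite -m2 Dm exprMn mulrC mulKf // expf_neq0.
    by rewrite -[1%VS]/(1%AS : {vspace L}) rpred_div ?rpredX ?rpred_int ?rpred_nat.
  case/negP: q2'd; apply/dvdzP; exists c; apply: (@intrL_inj L).
  by rewrite -m2 Dm exprMn Dc rmorphM /= rmorphXn /= mulrC.
exists k%:~R; split; first exact: integral_intr.
by rewrite m2 Dk rmorphM mulrC.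
Qed.

(* [2] divides the square of [1 + m] but not [1 + m] itself. *)
Lemma ramified_two_sqrt m k : m ^+ 2 = (4 * k - 1)%:~R -> ramified L 2.
Proof.
move=> m2; have im := integral_sqrt m2; exists (1 + m), 2; split.
- by apply: integralD => //; exact: integral1.
- case=> y [iy Dy].
  have : (2%:Z %| 1 - 2 * k)%Z; last by lia.
  apply: (@integral_half_even (y * (1 - y))).
    by apply: integralM => //; apply: integralB => //; exact: integral1.
  have nz2 : (2 : L) != 0 by rewrite natrL_eq0.
  have Dm : m = 2 * y - 1 by rewrite -Dy; ring.
  apply: (mulfI nz2); rewrite (_ : _ * _ = 1 - m ^+ 2); last by rewrite Dm; ring.
  by rewrite m2 !rmorphB !rmorphM /=; ring.
exists ((2 * k)%:~R + m); split; first by apply: integralD => //; exact: integral_intr.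
by rewrite sqrrD m2 rmorphB !rmorphM /= expr1n; ring.
Qed.

Hypothesis galL : galois 1 {:L}.

Lemma dvd_trace_nilpotent x y n q : prime q -> integral x -> integral y ->
  (exists z, integral z /\ x ^+ n = q%:R * z) ->
  exists k, \sum_(g : gal_of {:L}) g (x * y) = q%:R * k%:~R.
Proof.
move=> pr_q ix iy [z [iz Dxn]]; have [P Pq] := prime_over_exists L pr_q.
have Pgx (g : gal_of {:L}) : P (g x).
  apply: (ideal_of_exp Pq (n := n)); first exact: integral_gal.
  rewrite -rmorphXn /= Dxn rmorphM rmorph_nat /=.
  exact: (ideal_mulr Pq (integral_gal g iz) (proj2 Pq)).
have [t Dt] := integral_trace galL (integralM ix iy).
have /(ideal_intr pr_q Pq)/dvdzP[k Dk] : P t%:~R.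
  rewrite -Dt; apply: (ideal_sum Pq) => g _; rewrite rmorphM /=.
  by apply: (ideal_mulr Pq) => //; exact: integral_gal.
by exists k; rewrite Dt Dk rmorphM mulrC.
Qed.

Variables (J : finType) (a b : J -> L) (d : int).
Hypotheses (ia : forall j, integral (a j)) (ib : forall j, integral (b j)).
Hypothesis dual_ab : forall g : gal_of {:L},
  \sum_j g (a j) * b j = if g == 1%g then d%:~R else 0.

Lemma dual_trace_expansion x :
  d%:~R * x = \sum_j (\sum_(g : gal_of {:L}) g (x * a j)) * b j.
Proof.
under [RHS]eq_bigr do rewrite mulr_suml.
rewrite exchange_big (bigD1 1%g) //= [X in _ = _ + X]big1 => [|g ntg].
  rewrite addr0; under [RHS]eq_bigr do rewrite rmorphM -mulrA.
  by rewrite -mulr_sumr /= dual_ab eqxx gal_id mulrC.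
under eq_bigr do rewrite rmorphM -mulrA.
by rewrite -mulr_sumr /= dual_ab (negPf ntg) mulr0.
Qed.

Lemma unramified_of_dual q : prime q -> ~~ (q%:Z %| d)%Z -> ~ ramified L q.
Proof.
move=> pr_q q'd [x [n [ix Nx qxn]]].
have [k Dk] := fin_all_exists (fun j => dvd_trace_nilpotent pr_q ix (ia j) qxn).
pose y := \sum_j (k j)%:~R * b j.
have iy : integral y.
  by apply: integral_sum => j _; apply: integralM => //; exact: integral_intr.
have Dxy : d%:~R * x = q%:R * y.
  by rewrite dual_trace_expansion mulr_sumr; apply: eq_bigr => j _; rewrite Dk mulrA.
have : coprimez q%:Z d by rewrite coprimezE /= prime_coprime.
case/coprimezP=> -[u v] /= Duv; case: Nx; exists (u%:~R * x + v%:~R * y); split.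
  by apply: integralD; apply: integralM => //; exact: integral_intr.
rewrite mulrDr [q%:R * (v%:~R * y)]mulrCA -Dxy.
have {1}-> : x = (u * q%:Z + v * d)%:~R * x by rewrite Duv mul1r.
by rewrite rmorphD !rmorphM /=; ring.
Qed.

End Ramification.

(** * Multiquadratic fields *)

Lemma decomp_fixes_sqrt_residue (L : splittingFieldType rat) (P : L -> Prop) (p : nat)
    (g : gal_of {:L}) (m : L) (k : int) :
  prime p -> odd p -> lies_over P p -> decomp_mem P g ->
  m ^+ 2 = k%:~R -> qchar (k%:~R : 'F_p) = 1 -> g m = m.
Proof.
move=> pr_p odd_p Pp Dg m2 /eqP/qchar1P[nz_k [y Dy]]; have im := integral_sqrt m2.
have [a Pma] : exists a : int, P (m - a%:~R).
  pose a := (y : nat)%:Z; have ia : integral (a%:~R : L) := integral_intr _ a.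
  have : P ((m - a%:~R) * (m + a%:~R)).
    rewrite -subr_sqr m2 -rmorphXn -rmorphB /=; apply/(ideal_intr pr_p Pp).
    rewrite (dvdz_pcharf (pchar_Fp pr_p)) rmorphB rmorphXn /= -Dy.
    by rewrite [_%:~R](natr_Zp y) subrr.
  case/(ideal_prime Pp)=> [||PM|PM]; [exact: integralB | exact: integralD | by exists a |].
  by exists (- a); rewrite rmorphN opprK.
have [// | gm] := gal_sqrt_intr g m2; case/negP: nz_k.
rewrite -(dvdz_pcharf (pchar_Fp pr_p)); apply/(ideal_intr pr_p Pp).
rewrite -m2; apply: (ideal_exp Pp); apply: (ideal_of_double pr_p Pp) => //.
have := (Dg (m - a%:~R)).2 Pma; rewrite rmorphB /= gm rmorph_int => Pgma.
by congr P: (idealB Pp Pma Pgma); ring.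
Qed.

Section SignCharacter.
Variables (L : splittingFieldType rat) (chi : gal_of {:L} -> int).
Hypothesis galL : galois 1 {:L}.
Hypotheses (chiM : {morph chi : g h / (g * h)%g >-> g * h})
           (chi_sqr : forall g, chi g ^+ 2 = 1).
Implicit Types (g h : gal_of {:L}) (x y : L).

Definition eigenvector x := forall g, g x = (chi g)%:~R * x.

Definition twisted_trace x : L := \sum_g (chi g)%:~R * g x.

Lemma eigenvector_twisted_trace x : eigenvector (twisted_trace x).
Proof.
move=> h; rewrite rmorph_sum mulr_sumr [RHS](reindex_inj (mulIg h)) /=.
apply: eq_bigr => g _; rewrite galMx chiM rmorphM /= rmorph_int mulrA -rmorphM /=.
by rewrite mulrCA -expr2 chi_sqr mulr1.
Qed.

Lemma integral_twisted_trace x : integral x -> integral (twisted_trace x).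
Proof.
move=> ix; apply: integral_sum => g _.
by apply: integralM; [exact: integral_intr | exact: integral_gal].
Qed.

Lemma eigenvector_mul_rat x y : eigenvector x -> eigenvector y -> x * y \in 1%VS.
Proof.
move=> ex ey; apply: (gal_fixed_rat galL) => g.
by rewrite rmorphM /= ex ey mulrACA -rmorphM /= -expr2 chi_sqr mul1r.
Qed.

Lemma integral_eigenvector_multiple x y (d : int) :
  eigenvector y -> y ^+ 2 = d%:~R -> squarefree d ->
  eigenvector x -> integral x -> exists c : int, x = c%:~R * y.
Proof.
move=> ey y2 sq_d ex ix; have iy := integral_sqrt y2.
have nz_y : y != 0 by rewrite -sqrf_eq0 y2 intrL_eq0 squarefree_neq0.
have [n Dn] := integral_rat (integralM ix iy) (eigenvector_mul_rat ex ey).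
have [k Dk] := integral_rat (integralM ix ix) (eigenvector_mul_rat ex ex).
have /(squarefree_dvd_sqr sq_d)/dvdzP[c Dc] : (d %| n ^+ 2)%Z.
  apply/dvdzP; exists k; apply: (@intrL_inj L).
  by rewrite rmorphXn rmorphM /= -Dn -Dk -y2 exprMn expr2.
by exists c; apply: (mulIf nz_y); rewrite Dn Dc rmorphM /= -y2 expr2 mulrA.
Qed.

Lemma twisted_trace_neq0 : exists x, twisted_trace x != 0.
Proof.
apply: contrapT => trace0.
have {}trace0 x : x \in {:L}%VS -> twisted_trace x = 0.
  by move=> _; apply/eqP; apply: contrapT => /negP nz; apply: trace0; exists x.
have /eqP := @gal_independent _ L {:L}%AS predT (fun g => (chi g)%:~R) trace0 1%g isT.
by rewrite intrL_eq0 -sqrf_eq0 chi_sqr.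
Qed.

Lemma squarefree_eigenvector y (d : int) :
  y != 0 -> eigenvector y -> y ^+ 2 = d%:~R ->
  exists (m : L) (e : int), [/\ eigenvector m, m ^+ 2 = e%:~R & squarefree e].
Proof.
have [n] := ubnP `|d|%N; elim: n => // n IHn in y d * => /ltnSE led nz_y ey y2.
have nz_d : d != 0 by rewrite -(intrL_eq0 L) -y2 sqrf_eq0.
have [[q [pr_q /dvdzP[e De]]] | sq_d] :=
  pselect (exists q : nat, prime q /\ ((q%:Z ^+ 2)%R %| d)%Z); last first.
  by exists y, d; split=> // q pr_q; apply/negP => q2d; apply: sq_d; exists q.
have nz_q := natrL_prime_neq0 L pr_q.
apply: (IHn (y / q%:R) e).
- apply: leq_trans led; rewrite De abszM abszX ltn_Pmulr //.
    by rewrite -(exp1n 2) ltn_exp2r // prime_gt1.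
  by rewrite absz_gt0; apply: contraNneq nz_d => e0; rewrite De e0 mul0r.
- by rewrite mulf_neq0 // invr_eq0.
- by move=> g; rewrite rmorphM fmorphV rmorph_nat /= ey mulrA.
by rewrite expr_div_n y2 De rmorphM rmorphXn /= mulfK // expf_neq0.
Qed.

Lemma squarefree_eigenvector_exists :
  exists (m : L) (e : int), [/\ eigenvector m, m ^+ 2 = e%:~R & squarefree e].
Proof.
have [x nz_tx] := twisted_trace_neq0; have ex := eigenvector_twisted_trace x.
have /vlineP[r Dr] := eigenvector_mul_rat ex ex.
pose k : L := (denq r)%:~R; have nz_k : k != 0 by rewrite intrL_eq0 denq_eq0.
apply: (@squarefree_eigenvector (k * twisted_trace x) (numq r * denq r)).
- exact: mulf_neq0.
- by move=> g; rewrite rmorphM /= rmorph_int ex mulrCA.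
rewrite exprMn [twisted_trace x ^+ 2]expr2 Dr -{1}(divq_num_den r) -[_%:A]/(in_alg L _).
by rewrite (rmorphM (in_alg L)) fmorphV !rmorph_int rmorphM /= -/k; field.
Qed.

End SignCharacter.

Definition symdiff (I : finType) (A B : {set I}) : {set I} := [set j | (j \in A) (+) (j \in B)].

Lemma in_symdiff (I : finType) (A B : {set I}) j :
  (j \in symdiff A B) = (j \in A) (+) (j \in B).
Proof. by rewrite inE. Qed.

Lemma symdiffvv (I : finType) (A : {set I}) : symdiff A A = set0.
Proof. by apply/setP=> j; rewrite in_symdiff addbb inE. Qed.

Definition moved (L : splittingFieldType rat) (I : finType) (m : I -> L) (g : gal_of {:L})
  : {set I} := [set j | g (m j) != m j].

Section Multiquadratic.
Variables (L : splittingFieldType rat) (I : finType) (d : I -> int) (m : I -> L).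
Hypothesis galL : galois 1 {:L}.
Hypotheses (sq_prod_d : squarefree (\prod_j d j)) (d_neq1 : forall j, `|d j|%N != 1%N).
Hypothesis m_sqr : forall j, m j ^+ 2 = (d j)%:~R.
Hypothesis m_faithful : forall g : gal_of {:L}, (forall j, g (m j) = m j) -> g = 1%g.
Implicit Types (g h : gal_of {:L}) (A : {set I}) (x y : L) (j k : I).

Definition sqrt_sign g A : int := \prod_(j in A) (-1) ^+ (j \in moved m g).

Definition prod_sqrt A : L := \prod_(j in A) m j.

Definition prod_disc A : int := \prod_(j in A) d j.

Lemma squarefree_prod_disc A : squarefree (prod_disc A).
Proof.
apply: squarefree_dvd sq_prod_d.
by rewrite /prod_disc [X in (_ %| X)%Z](bigID (mem A)) /= dvdz_mulr.
Qed.

Lemma squarefree_disc j : squarefree (d j).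
Proof. by have := squarefree_prod_disc [set j]; rewrite /prod_disc big_set1. Qed.

Lemma sqrt_disc_neq0 j : m j != 0.
Proof. by rewrite -sqrf_eq0 m_sqr intrL_eq0 squarefree_neq0 //; exact: squarefree_disc. Qed.

Lemma sqr_prod_sqrt A : prod_sqrt A ^+ 2 = (prod_disc A)%:~R.
Proof. by rewrite -prodrXl rmorph_prod /=; apply: eq_bigr => j _; exact: m_sqr. Qed.

Lemma gal_sqrt g j : g (m j) = (-1) ^+ (j \in moved m g) * m j.
Proof.
rewrite inE; have [-> | neq] := eqVneq (g (m j)) (m j); first by rewrite mul1r.
by rewrite mulN1r; case: (gal_sqrt_intr g (m_sqr j)) => // fixed; rewrite fixed eqxx in neq.
Qed.

Lemma gal_prod_sqrt g A : g (prod_sqrt A) = (sqrt_sign g A)%:~R * prod_sqrt A.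
Proof.
rewrite !rmorph_prod -big_split /=; apply: eq_bigr => j _.
by rewrite gal_sqrt rmorphXn /= rmorphN1.
Qed.

Lemma moved1 : moved m 1%g = set0.
Proof. by apply/setP=> j; rewrite !inE gal_id eqxx. Qed.

Lemma movedM : {morph moved m : g h / (g * h)%g >-> symdiff g h}.
Proof.
move=> g h; apply/setP=> j; rewrite in_symdiff.
apply: (@signr_inj int); apply: (@intrL_inj L); apply: (mulIf (sqrt_disc_neq0 j)).
by rewrite !rmorph_sign -gal_sqrt signr_addb galMx gal_sqrt rmorphM rmorph_sign /= gal_sqrt mulrA.
Qed.

Lemma moved_eq0 g : moved m g = set0 -> g = 1%g.
Proof. by move=> g0; apply: m_faithful => j; rewrite gal_sqrt g0 inE mul1r. Qed.

Lemma moved_neq1 g : g != 1%g -> exists j, j \in moved m g.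
Proof. by move=> ntg; apply/set0Pn; apply: contraNneq ntg => /moved_eq0 ->. Qed.

Lemma moved_inj : injective (moved m).
Proof.
move=> g h eq_gh; apply: (mulgI g).
have sqr1 : (g * g = 1)%g.
  by apply: moved_eq0; rewrite movedM symdiffvv.
by rewrite sqr1; apply/esym/moved_eq0; rewrite movedM eq_gh symdiffvv.
Qed.

Lemma sqrt_signM A : {morph sqrt_sign^~ A : g h / (g * h)%g >-> g * h}.
Proof.
move=> g h; rewrite /sqrt_sign -big_split; apply: eq_bigr => j _.
by rewrite movedM in_symdiff signr_addb.
Qed.

Lemma sqr_sqrt_sign g A : sqrt_sign g A ^+ 2 = 1.
Proof. by rewrite -prodrXl big1 // => j _; rewrite sqrr_sign. Qed.

Lemma sum_sqrt_sign g : \sum_A sqrt_sign g A = if g == 1%g then 2 ^+ #|I| else 0.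
Proof.
have -> : \sum_A sqrt_sign g A = \prod_j ((-1) ^+ (j \in moved m g) + 1).
  rewrite bigA_distr; apply: eq_big => // A _; rewrite /sqrt_sign big_mkcond /=.
  by apply: eq_bigr.
have [-> | ntg] := eqVneq g 1%g.
  by rewrite (eq_bigr (fun=> 2)) ?prodr_const // => j _; rewrite moved1 inE.
have [j Mj] := moved_neq1 ntg.
by rewrite (bigD1 j) //= Mj addNr mul0r.
Qed.

Lemma sum_gal_sqrt_sign A : A != set0 -> \sum_(g : gal_of {:L}) sqrt_sign g A = 0.
Proof.
case/set0Pn=> j Aj; have [h sgn_h | sgn1] := pickP (fun h => sqrt_sign h A != 1).
  have sgnN : sqrt_sign h A = -1.
    by have /eqP := sqr_sqrt_sign h A; rewrite sqrf_eq1 (negPf sgn_h) => /eqP.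
  by apply: (sum_sign_reversing (mulIg h)) => g; rewrite sqrt_signM sgnN mulrN1.
have [||n Dn] := @gal_fixed_int _ galL (prod_sqrt A).
- exact: integral_sqrt (sqr_prod_sqrt A).
- by move=> g; rewrite gal_prod_sqrt; have /negbFE/eqP-> := sgn1 g; rewrite mul1r.
have Dn2 : n ^+ 2 = prod_disc A.
  by apply: (@intrL_inj L); rewrite rmorphXn /= -Dn sqr_prod_sqrt.
have n1 : `|n|%N = 1%N by apply: squarefree_sqr; rewrite Dn2; exact: squarefree_prod_disc.
have := congr1 absz Dn2; rewrite abszX n1 /prod_disc (bigD1 j) //= abszM => /esym/eqP.
by rewrite muln_eq1 (negPf (d_neq1 j)).
Qed.

Lemma card_gal_multiquadratic : #|{: gal_of {:L}}| = (2 ^ #|I|)%N.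
Proof.
have : \sum_A \sum_(g : gal_of {:L}) sqrt_sign g A = (2 ^ #|I|)%N%:Z.
  rewrite exchange_big (bigD1 1%g) //= sum_sqrt_sign eqxx big1 => [|g /negPf g1].
    by rewrite addr0 -natz natrX.
  by rewrite sum_sqrt_sign g1.
rewrite (bigD1 set0) //= [X in _ + X]big1 ?addr0; last by move=> A; exact: sum_gal_sqrt_sign.
under eq_bigr do rewrite /sqrt_sign big_set0.
by rewrite sumr_const natz => -[].
Qed.

Lemma moved_bij : bijective (moved m).
Proof.
apply: (inj_card_bij moved_inj).
by rewrite card_gal_multiquadratic -cardsT -powersetT card_powerset cardsT.
Qed.

Lemma integral_sqrt_span x : integral x ->
  exists c : {set I} -> int, 2 ^+ #|I| * x = \sum_A (c A)%:~R * prod_sqrt A.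
Proof.
move=> ix; pose component A := twisted_trace (sqrt_sign^~ A) x.
have multiple A : exists c : int, component A = c%:~R * prod_sqrt A.
  apply: (integral_eigenvector_multiple galL (sqr_sqrt_sign^~ A)).
  - by move=> g; exact: gal_prod_sqrt.
  - exact: sqr_prod_sqrt.
  - exact: squarefree_prod_disc.
  - by apply: eigenvector_twisted_trace; [exact: sqrt_signM | move=> g; exact: sqr_sqrt_sign].
  exact: integral_twisted_trace.
have [c Dc] := fin_all_exists multiple; exists c.
under [RHS]eq_bigr do rewrite -Dc /component /twisted_trace.
rewrite exchange_big (bigD1 1%g) //=.
rewrite -mulr_suml -rmorph_sum sum_sqrt_sign eqxx big1 => [|g /negPf g1].
  by rewrite addr0 gal_id /= rmorphXn.
by rewrite -mulr_suml -rmorph_sum sum_sqrt_sign g1 mul0r.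
Qed.

Lemma multiquadratic_integral_ind (Q : L -> Prop) :
  (forall k : int, Q k%:~R) -> (forall j, Q (m j)) ->
  (forall x y, Q x -> Q y -> Q (x + y)) -> (forall x y, Q x -> Q y -> Q (x * y)) ->
  forall x, integral x -> Q (2 ^+ #|I| * x).
Proof.
move=> Qint Qm QD QM x /integral_sqrt_span[c ->].
elim/big_ind: _ => [||A _]; [exact: (Qint 0) | exact: QD |].
apply: (QM) => //; rewrite /prod_sqrt; elim/big_ind: _ => [||j _].
- exact: (Qint 1).
- exact: QM.
exact: Qm.
Qed.

(* With [n = 0] the conclusion says that [g] is in the inertia group, with [n.+1 = q] that
   it is a Frobenius element. *)
Lemma gal_congr_of_sqrt (P : L -> Prop) (q n : nat) g :
  prime q -> odd q -> lies_over P q ->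
  (forall x y, integral x -> integral y ->
     P ((x + y) ^+ n.+1 - (x ^+ n.+1 + y ^+ n.+1))) ->
  (forall k : int, P (k%:~R ^+ n.+1 - k%:~R)) ->
  (forall j, P (g (m j) - m j ^+ n.+1)) ->
  forall x, integral x -> P (g x - x ^+ n.+1).
Proof.
move=> pr_q odd_q Pq exprD_P intr_P sqrt_P x ix.
pose Q y := integral y /\ P (g y - y ^+ n.+1).
have [_ PNx] : Q (2 ^+ #|I| * x).
  apply: multiquadratic_integral_ind => // [k|j|y z [iy Py] [iz Pz]|y z [iy Py] [iz Pz]].
  - split; first exact: integral_intr.
    by rewrite rmorph_int -opprB; exact: (idealN Pq).
  - by split=> //; exact: integral_sqrt (m_sqr j).
  - split; first exact: integralD.
    by congr P: (idealB Pq (idealD Pq Py Pz) (exprD_P y z iy iz)); rewrite rmorphD /=; ring.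
  split; first exact: integralM.
  have Pgyz := ideal_mull Pq (integral_gal g iy) Pz.
  have Pyz := ideal_mulr Pq (integralX n.+1 iz) Py.
  by congr P: (idealD Pq Pgyz Pyz); rewrite rmorphM /= exprMn; ring.
pose N : int := 2 ^+ #|I|; have N2 : 2 ^+ #|I| = N%:~R :> L by rewrite rmorphXn.
have igx : integral (g x - x ^+ n.+1).
  by apply: integralB; [exact: integral_gal | exact: integralX].
apply: (ideal_cancel_intr pr_q Pq (k := N)) => //.
  rewrite dvdzE abszX /= Euclid_dvdX // dvdn_prime2 //.
  by apply/negP => /andP[/eqP q2 _]; move: odd_q; rewrite q2.
have P_N := ideal_mulr Pq (integralX n.+1 ix) (intr_P N).
rewrite N2 in PNx.
by congr P: (idealD Pq PNx P_N); rewrite rmorphM /= rmorph_int exprMn; ring.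
Qed.

Hypothesis d_mod4 : forall j, (4%:Z %| 1 - d j)%Z.

Definition omega j : L := (1 + m j) / 2.

Lemma sqrt_omega j : m j = omega j *+ 2 - 1.
Proof.
rewrite -[_ *+ 2]mulr_natr /omega divfK ?natrL_eq0 //.
by rewrite addrAC subrr add0r.
Qed.

Lemma integral_omega j : integral (omega j).
Proof.
have /dvdzP[k Dk] := d_mod4 j.
exists ('X * ('X - 1%:P) + k%:P); split.
  rewrite monicE lead_coefDl ?lead_coefM ?lead_coefX ?lead_coefXsubC ?mulr1 //.
  by rewrite mulrC size_mulX ?polyXsubC_eq0 // size_XsubC (leq_ltn_trans (size_polyC_leq1 _)).
rewrite rmorphD rmorphM rmorphB /= map_polyX !map_polyC /= /root !hornerE.
have nz4 : (4 : L) != 0 by rewrite natrL_eq0.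
apply/eqP/(mulfI nz4); rewrite mulr0.
have Dk4 : 1 - m j ^+ 2 = k%:~R * 4.
  by have := congr1 (intr : int -> L) Dk; rewrite rmorphB rmorphM /= -m_sqr.
transitivity (k%:~R * 4 - (1 - m j ^+ 2)); last by rewrite Dk4 subrr.
by rewrite /omega; field; rewrite natrL_eq0.
Qed.

Lemma gal_omega g j : g (omega j) = if j \in moved m g then 1 - omega j else omega j.
Proof.
have nz2 : (2 : L) != 0 by rewrite natrL_eq0.
rewrite /omega rmorphM rmorphD fmorphV rmorph1 rmorph_nat /= gal_sqrt.
by case: ifP => _; rewrite ?mulN1r ?mul1r //; field.
Qed.

Lemma unramified_multiquadratic q :
  prime q -> (forall j, ~~ (q%:Z %| d j)%Z) -> ~ ramified L q.
Proof.
move=> pr_q q'd; have i_omega := integral_omega; have i_sqrt j := integral_sqrt (m_sqr j).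
have i_conj j : integral (1 - omega j) by apply: integralB => //; exact: integral1.
(* The products of conjugates of the [omega j] and, up to the factor [\prod_j d j], the dual
   family for the trace form. *)
pose a (B : {set I}) := \prod_j (if j \in B then omega j else 1 - omega j).
pose b (B : {set I}) := \prod_j (if j \in B then m j * omega j else - (m j * (1 - omega j))).
apply: (@unramified_of_dual L galL _ a b (\prod_j d j)) => // [B|B|g|].
- by apply: integral_prod => j _; case: ifP.
- by apply: integral_prod => j _; case: ifP => _; [|apply: integralN]; exact: integralM.
- have -> : \sum_B g (a B) * b B =
    \prod_j (g (omega j) * (m j * omega j) + g (1 - omega j) * - (m j * (1 - omega j))).
    rewrite bigA_distr; apply: eq_big => // B _; rewrite /a rmorph_prod -big_split /=.
    by apply: eq_bigr => j _; case: ifP.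
  have [-> | ntg] := eqVneq g 1%g.
    rewrite rmorph_prod; apply: eq_bigr => j _ /=.
    by rewrite -m_sqr !gal_id [m j]sqrt_omega; ring.
  have [j Mj] := moved_neq1 ntg.
  rewrite (bigD1 j) //= [X in X * _](_ : _ = 0) ?mul0r //.
  by rewrite rmorphB rmorph1 /= gal_omega Mj; ring.
rewrite dvdzE (big_morph absz abszM (erefl _)) Euclid_dvd_prod //.
by rewrite big1 // => j _; apply/negbTE/q'd.
Qed.

Lemma ramified_multiquadraticP q :
  prime q -> ramified L q <-> exists j, (q%:Z %| d j)%Z.
Proof.
move=> pr_q; split=> [ram | [j q_dj]].
  by apply/existsP; apply: contraPT ram => /existsPn; exact: unramified_multiquadratic.
by apply: (ramified_sqrt (m_sqr j)) => //; exact: squarefree_disc.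
Qed.

Definition divisible_discs (q : nat) : {set I} := [set j | (q%:Z %| d j)%Z].

Definition nonresidue_discs (q : nat) : {set I} := [set j | qchar ((d j)%:~R : 'F_q) == -1].

Lemma divisible_discs_two : divisible_discs 2 = set0.
Proof. by apply/setP=> j; rewrite !inE; have := d_mod4 j; lia. Qed.

Section AtPrime.
Variables (P : L -> Prop) (q : nat).
Hypotheses (pr_q : prime q) (Pq : lies_over P q).

Let P_sqrt j : j \in divisible_discs q -> P (m j).
Proof.
rewrite inE => q_dj; apply: (ideal_of_exp Pq (n := 2)); first exact: integral_sqrt (m_sqr j).
by rewrite m_sqr; apply/(ideal_intr pr_q Pq).
Qed.

Let P_intr (k : int) : k%:~R = 0 :> 'F_q -> P k%:~R.
Proof. by move/eqP; rewrite -(dvdz_pcharf (pchar_Fp pr_q)) => /(ideal_intr pr_q Pq). Qed.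

Lemma inertia_moved g : inertia_mem P g -> moved m g \subset divisible_discs q.
Proof.
case=> _ Ig; apply/subsetP=> j Mj; rewrite inE; apply/(ideal_intr pr_q Pq).
have := Ig _ (integral_omega j); rewrite gal_omega Mj => Phalf.
rewrite -m_sqr -sqrrN; apply: (ideal_exp Pq).
by congr P: Phalf; rewrite [in RHS]sqrt_omega; ring.
Qed.

Lemma inertia_multiquadraticP g : inertia_mem P g <-> moved m g \subset divisible_discs q.
Proof.
split=> [|/subsetP Mg]; first exact: inertia_moved.
have [q2 | odd_q] := even_prime pr_q.
  have -> : g = 1%g.
    apply: moved_eq0; apply/eqP; rewrite -subset0 -divisible_discs_two -q2.
    exact/subsetP.
  by split=> [x | x _]; rewrite gal_id // subrr; exact: (ideal0 Pq).
have Pgx : forall x, integral x -> P (g x - x ^+ 1).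
  apply: (gal_congr_of_sqrt pr_q odd_q Pq) => [x y _ _ | k | j].
  - by rewrite !expr1 subrr; exact: (ideal0 Pq).
  - by rewrite expr1 subrr; exact: (ideal0 Pq).
  rewrite expr1 gal_sqrt; case: (boolP (j \in _)) => [/Mg/P_sqrt Pm | _]; last first.
    by rewrite mul1r subrr; exact: (ideal0 Pq).
  by rewrite mulN1r; apply: (idealB Pq) => //; exact: (idealN Pq).
split=> [|x /Pgx]; last by rewrite expr1.
exact: (decomp_mem_of_congr Pq Pgx).
Qed.

Hypothesis odd_q : odd q.

Lemma Frobenius_multiquadratic g :
  moved m g :\: divisible_discs q = nonresidue_discs q ->
  forall x, integral x -> P (g x - x ^+ q).
Proof.
move=> Mg; rewrite -(prednK (prime_gt0 pr_q)).
apply: (gal_congr_of_sqrt pr_q odd_q Pq) => [x y | k | j]; rewrite prednK ?prime_gt0 //.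
- exact: ideal_exprD_prime.
- exact: ideal_intr_Frobenius.
have [Rj | R'j] := boolP (j \in divisible_discs q).
  apply: (idealB Pq).
    rewrite gal_sqrt; apply: (ideal_mull Pq) (P_sqrt Rj).
    by rewrite -(rmorph_sign intr); exact: integral_intr.
  by rewrite -(prednK (prime_gt0 pr_q)); apply: (ideal_exp Pq); exact: P_sqrt.
have nz_d : ((d j)%:~R : 'F_q) != 0.
  by move: R'j; rewrite inE (dvdz_pcharf (pchar_Fp pr_q)).
have Mj : (-1) ^+ (j \in moved m g) = qchar ((d j)%:~R : 'F_q).
  have -> : (j \in moved m g) = (j \in moved m g :\: divisible_discs q) by rewrite in_setD R'j.
  by rewrite Mg inE; case: (qchar_neq0 nz_d) => ->.
have -> : g (m j) - m j ^+ q =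
    (qchar ((d j)%:~R : 'F_q) - d j ^+ (q.-1)./2)%:~R * m j.
  rewrite gal_sqrt -(rmorph_sign intr) Mj rmorphB rmorphXn /= -m_sqr mulrBl; congr (_ - _).
  by rewrite -exprM mul2n odd_half_predK // -exprSr prednK // prime_gt0.
apply: (ideal_mulr Pq); first exact: integral_sqrt (m_sqr j).
apply: P_intr; rewrite rmorphB rmorphXn /=.
by rewrite (Euler_criterion_pchar _ (pchar_Fp pr_q)) // subrr.
Qed.

Lemma decomp_multiquadraticP g : decomp_mem P g <->
  moved m g :\: divisible_discs q = set0 \/
  moved m g :\: divisible_discs q = nonresidue_discs q.
Proof.
split=> [Dg | []]; last 2 first.
- by move/eqP; rewrite setD_eq0 => /inertia_multiquadraticP[].
- move=> Mg; apply: (decomp_mem_of_congr Pq (n := q.-1)).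
  by rewrite prednK ?prime_gt0 //; exact: Frobenius_multiquadratic.
have residue_fixed M (e : int) : M ^+ 2 = e%:~R -> qchar (e%:~R : 'F_q) = 1 -> g M = M.
  exact: (decomp_fixes_sqrt_residue pr_q odd_q Pq Dg).
have sub : moved m g :\: divisible_discs q \subset nonresidue_discs q.
  apply/subsetP=> j; rewrite !inE (dvdz_pcharf (pchar_Fp pr_q)) => /andP[nz_d Mj].
  case: (qchar_neq0 nz_d) => chi_d; last by rewrite chi_d.
  by rewrite (residue_fixed _ _ (m_sqr j) chi_d) eqxx in Mj.
have [-> | [j Mj]] := set_0Vmem (moved m g :\: divisible_discs q); [by left | right].
(* If [d j] and [d k] are nonresidues, then [g] fixes [m j * m k], so it moves both or none. *)
apply/eqP; rewrite eqEsubset sub; apply/subsetP=> k Rk.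
have Rj := subsetP sub j Mj; move: Rj Rk Mj; rewrite !in_set => /eqP chi_j /eqP chi_k.
rewrite !(dvdz_pcharf (pchar_Fp pr_q)) -(qchar_eq0 (d k)%:~R) chi_k /= => /andP[_ Mj].
have := residue_fixed (m j * m k) (d j * d k).
rewrite exprMn !m_sqr !rmorphM /= qcharM ?odd_card_Fp // chi_j chi_k => /(_ erefl erefl).
move/eqP; apply: contraL => /eqP gmk; rewrite gmk -subr_eq0 -mulrBl.
by rewrite mulf_neq0 ?sqrt_disc_neq0 // subr_eq0.
Qed.

End AtPrime.

Lemma tame_multiquadratic : tamely_ramified L.
Proof.
move=> q P pr_q Pq; pose R := divisible_discs q; exists (moved m @^-1: powerset R); split.
  move=> g; rewrite !inE; split=> [Mg | [_ /(inertia_multiquadraticP pr_q Pq)] //].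
  by split; [exact: mem_Gal1 | exact/(inertia_multiquadraticP pr_q Pq)].
rewrite (on_card_preimset (onW_bij _ moved_bij)) card_powerset Euclid_dvdX // dvdn_prime2 //.
by apply/negP => /andP[/eqP q2]; rewrite /R q2 divisible_discs_two cards0.
Qed.

End Multiquadratic.

(** * Tame configurations *)

Lemma setD1_notin (I : finType) (A : {set I}) i : i \notin A -> A :\ i = A.
Proof.
move=> A'i; apply/setP=> j; rewrite in_setD1.
by have [-> | //] := eqVneq j i; rewrite (negPf A'i).
Qed.

Lemma abelem2_cycle (gT : finGroupType) (G : {group gT}) (h : gT) :
  (2.-abelem G)%g -> h \in G -> <[h]>%g = [set 1%g; h].
Proof.
move=> abelG Gh; have [-> | nth] := eqVneq h 1%g; first by rewrite cycle1 setUid.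
apply/esym/eqP; rewrite eqEcard subUset !sub1set group1 cycle_id /=.
by rewrite -orderE (abelem_order_p abelG) // cards2 eq_sym nth.
Qed.

Definition supp (s : nat) (gT : finGroupType) (T : 'I_s -> {group gT}) (h : gT) : {set 'I_s} :=
  [set j | h \notin prod_except T j].

Canonical prod_except_group (s : nat) (gT : finGroupType) (T : 'I_s -> {group gT}) (i : 'I_s)
  : {group gT} := [group of prod_except T i].

Section Configuration.
Local Open Scope group_scope.
Variables (s : nat) (gT : finGroupType) (G : {group gT}) (T Z : 'I_s -> {group gT}).
Hypothesis cfg : tame_config G T Z.
Implicit Types (g h : gT) (A : {set 'I_s}) (i j k : 'I_s).

Let abelG : 2.-abelem G. Proof. by case: cfg. Qed.
Let abelianG : abelian G. Proof. exact: abelem_abelian abelG. Qed.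
Let cardG : #|G| = (2 ^ s)%N. Proof. by case: cfg. Qed.
Let genG : <<\bigcup_(i < s) T i>> = G. Proof. by case: cfg. Qed.
Let sTZ i : T i \subset Z i. Proof. by case: cfg => _ _ _ /(_ i)[]. Qed.
Let sZG i : Z i \subset G. Proof. by case: cfg => _ _ _ /(_ i)[]. Qed.
Let sTG i : T i \subset G. Proof. exact: subset_trans (sTZ i) (sZG i). Qed.

Let mulgg h : h \in G -> h * h = 1.
Proof. by case/abelemP: abelG => // _ e2 /e2; rewrite expgS expg1. Qed.

Definition inertia_gen i : gT := odflt 1 [pick h | T i == <[h]> :> {set gT}].

Lemma inertia_genE i : T i = <[inertia_gen i]> :> {set gT}.
Proof.
rewrite /inertia_gen; case: pickP => [h /eqP // | noh].
by case: cfg => _ _ _ /(_ i)[/cyclicP[h Dh] _ _ _]; have := noh h; rewrite Dh eqxx.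
Qed.

Lemma mem_inertia_gen i : inertia_gen i \in T i.
Proof. by rewrite inertia_genE cycle_id. Qed.

Lemma inertia_gen_in_group i : inertia_gen i \in G.
Proof. exact: (subsetP (sTG i) _ (mem_inertia_gen i)). Qed.

Lemma prod_except_sub i : prod_except T i \subset G.
Proof. by rewrite gen_subG; apply/bigcupsP => k _. Qed.

(* The rank of [G] is [s], so no [s - 1] of the generators suffice. *)
Lemma inertia_gen_notin_prod_except i : inertia_gen i \notin prod_except T i.
Proof.
apply/negP => Kx; have gen_i : <<[set inertia_gen k | k in predC1 i]>> = G.
  apply/eqP; rewrite eqEsubset gen_subG; apply/andP; split.
    by apply/subsetP=> _ /imsetP[k _ ->]; exact: inertia_gen_in_group.
  have sK : prod_except T i \subset <<[set inertia_gen k | k in predC1 i]>>.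
    rewrite gen_subG; apply/bigcupsP => k ki.
    by rewrite inertia_genE cycle_subG mem_gen // imset_f.
  rewrite -genG gen_subG; apply/bigcupsP => k _.
  rewrite inertia_genE cycle_subG; have [-> | ki] := eqVneq k i.
    exact: subsetP sK _ Kx.
  by rewrite mem_gen // imset_f.
have := grank_min [set inertia_gen k | k in predC1 i].
rewrite gen_i (grank_abelian abelianG) (rank_abelem abelG) cardG pfactorK //.
rewrite leqNgt; case/negP; apply: leq_ltn_trans (leq_imset_card _ _) _.
by rewrite cardC1 card_ord ltn_predL (leq_ltn_trans _ (ltn_ord i)).
Qed.

Lemma prod_except_mul_gen i h :
  h \in G -> h \notin prod_except T i -> h * inertia_gen i \in prod_except T i.
Proof.
move=> Gh K'h; have sGKT : G \subset prod_except T i * T i.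
  rewrite -norm_joinEr; last first.
    by rewrite cents_norm // (sub_abelian_cent2 abelianG) ?prod_except_sub.
  rewrite -genG gen_subG; apply/bigcupsP => k _; have [-> | ki] := eqVneq k i.
    exact: joing_subr.
  by apply: subset_trans (joing_subl _ _); apply: sub_gen; exact: (bigcup_sup k).
case/mulsgP: (subsetP sGKT h Gh) => k t Kk.
rewrite inertia_genE (abelem2_cycle abelG (inertia_gen_in_group i)) !inE.
case/orP=> /eqP-> Dh; first by rewrite Dh mulg1 Kk in K'h.
by rewrite Dh -mulgA mulgg ?inertia_gen_in_group // mulg1.
Qed.

Lemma suppM : {in G &, {morph supp T : g h / g * h >-> symdiff g h}}.
Proof.
move=> g h Gg Gh; apply/setP=> j; rewrite !inE.
have [Kg | K'g] := boolP (g \in prod_except T j); first by rewrite groupMl.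
have [Kh | K'h] := boolP (h \in prod_except T j); first by rewrite groupMr // K'g.
have := groupM (prod_except_mul_gen Gg K'g) (prod_except_mul_gen Gh K'h).
rewrite (centsP abelianG h Gh _ (inertia_gen_in_group j)) mulgA -[g * _ * _]mulgA.
by rewrite mulgg ?inertia_gen_in_group // mulg1 => ->.
Qed.

Lemma supp1 : supp T 1 = set0.
Proof. by apply/setP=> j; rewrite !inE group1. Qed.

Lemma supp_inertia_gen i : supp T (inertia_gen i) = [set i].
Proof.
apply/setP=> j; rewrite !inE; have [-> | ji] := eqVneq j i.
  exact: inertia_gen_notin_prod_except.
apply/negbTE; rewrite negbK mem_gen //; apply/bigcupP; exists i; first by rewrite eq_sym.
exact: mem_inertia_gen.
Qed.

Lemma supp_prod (e : 'I_s -> gT) A :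
  (forall j, e j \in G) -> (forall j, supp T (e j) = [set j]) -> supp T (\prod_(j in A) e j) = A.
Proof.
move=> Ge supp_e; apply/setP=> k.
have /= [-> _] : (k \in supp T (\prod_(j in A) e j)) = \big[addb/false]_(j in A) (k == j) /\
    \prod_(j in A) e j \in G.
  apply: (big_rec2 (fun (b : bool) h => (k \in supp T h) = b /\ h \in G)).
    by rewrite supp1 inE.
  by move=> j b h _ [<- Gh]; rewrite suppM // in_symdiff supp_e inE groupM.
have [Ak | A'k] := boolP (k \in A).
  by rewrite (bigD1 k) //= eqxx big1 // => j /andP[_]; rewrite eq_sym => /negbTE.
by rewrite big1 // => j Aj; apply: contraNF A'k => /eqP->.
Qed.

Lemma supp_onto A : exists2 h, h \in G & supp T h = A.
Proof.
exists (\prod_(j in A) inertia_gen j).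
  by rewrite group_prod // => j _; exact: inertia_gen_in_group.
by apply: supp_prod => j; [exact: inertia_gen_in_group | exact: supp_inertia_gen].
Qed.

Lemma supp_inj : {in G &, injective (supp T)}.
Proof.
have im_supp : [set supp T h | h in G] = setT.
  by apply/setP=> A; rewrite inE; have [h Gh <-] := supp_onto A; rewrite imset_f.
by apply/imset_injP; rewrite im_supp cardG -powersetT card_powerset cardsT card_ord.
Qed.

Lemma mem_inertia i h : h \in G -> (h \in T i) = (supp T h \subset [set i]).
Proof.
move=> Gh; rewrite inertia_genE (abelem2_cycle abelG (inertia_gen_in_group i)) !inE subset1.
by rewrite -supp_inertia_gen -supp1 [RHS]orbC !(inj_in_eq supp_inj) ?group1 ?inertia_gen_in_group.
Qed.

Lemma cyclic_decomp_cap_prod_except i : cyclic (Z i :&: prod_except T i).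
Proof.
have iso : Z i :&: prod_except T i \isog (Z i :&: prod_except T i) / T i.
  apply: quotient_isog.
    by rewrite cents_norm // (sub_abelian_cent2 abelianG) // (subset_trans (subsetIl _ _)).
  apply/eqP; rewrite -subG1; apply/subsetP=> h; rewrite 2!inE => /and3P[Th _ Kh].
  move: Th; rewrite inertia_genE (abelem2_cycle abelG (inertia_gen_in_group i)) !inE.
  move=> /orP[] // /eqP Dh; have := inertia_gen_notin_prod_except i.
  by rewrite -Dh Kh.
rewrite (isog_cyclic iso); have [_ _ _ /(_ i)[_ _ _ cycZT]] := cfg.
by apply: cyclicS cycZT; rewrite quotientS ?subsetIl.
Qed.

Lemma zgen_cycle i : <[zgen T Z i]> = Z i :&: prod_except T i.
Proof.
rewrite /zgen; case: pickP => [z /andP[_ /eqP //] | noz].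
have /cyclicP[z Dz] := cyclic_decomp_cap_prod_except i.
by have := noz z; rewrite Dz eqxx cycle_id.
Qed.

Lemma mem_zgen i : zgen T Z i \in Z i :&: prod_except T i.
Proof. by rewrite -zgen_cycle cycle_id. Qed.

Lemma zgen_in_group i : zgen T Z i \in G.
Proof. by have /setIP[Zz _] := mem_zgen i; exact: subsetP (sZG i) _ Zz. Qed.

Lemma supp_zgen_notin i : i \notin supp T (zgen T Z i).
Proof. by have /setIP[_ Kz] := mem_zgen i; rewrite inE negbK. Qed.

Lemma supp_zgenD1 i : supp T (zgen T Z i) :\ i = supp T (zgen T Z i).
Proof. exact: setD1_notin (supp_zgen_notin i). Qed.

Lemma mem_decomp i h : h \in G ->
  (h \in Z i) = (supp T h :\ i == set0) || (supp T h :\ i == supp T (zgen T Z i)).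
Proof.
move=> Gh; have Gx := inertia_gen_in_group i.
have Zx : inertia_gen i \in Z i := subsetP (sTZ i) _ (mem_inertia_gen i).
have [h' [Gh' Dh' <-]] : exists h',
    [/\ h' \in G, supp T h' = supp T h :\ i & (h' \in Z i) = (h \in Z i)].
  have [hi | h'i] := boolP (i \in supp T h).
    exists (h * inertia_gen i); split; [exact: groupM | | exact: groupMr].
    apply/setP=> j; rewrite suppM // supp_inertia_gen in_symdiff in_setD1 in_set1.
    by have [-> | ji] := eqVneq j i; rewrite ?hi ?addbF.
  by exists h; split=> //; rewrite setD1_notin.
have Kh' : h' \in prod_except T i.
  have : i \notin supp T h' by rewrite Dh' setD11.
  by rewrite inE negbK.
have -> : (h' \in Z i) = (h' \in <[zgen T Z i]>) by rewrite zgen_cycle inE Kh' andbT.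
rewrite (abelem2_cycle abelG (zgen_in_group i)) !inE -Dh' -supp1.
by rewrite !(inj_in_eq supp_inj) ?group1 ?zgen_in_group.
Qed.

Lemma supp_zgen_unique i A : i \notin A ->
  (forall h, h \in G -> h \in Z i <-> supp T h :\ i = set0 \/ supp T h :\ i = A) ->
  supp T (zgen T Z i) = A.
Proof.
move=> A'i ZP; have Gz := zgen_in_group i; have /setIP[Zz _] := mem_zgen i.
have [h Gh Dh] := supp_onto A.
have /ZP[// | z0 | <-] := Zz; last by rewrite supp_zgenD1.
have : h \in Z i by apply/ZP => //; right; rewrite Dh setD1_notin.
by rewrite mem_decomp // Dh (setD1_notin A'i) -(supp_zgenD1 i) z0 orbb => /eqP.
Qed.

Lemma sign_matrixE i j :
  sign_matrix T Z i j = (if i == j then 0 else (-1) ^+ (j \in supp T (zgen T Z i)))%R.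
Proof. by rewrite /sign_matrix inE; case: (i == j) => //; case: (_ \in _). Qed.

End Configuration.

Section ConfigurationOfSupports.
Variables (s : nat) (R : 'I_s -> {set 'I_s}).
Hypothesis R_irr : forall i, i \notin R i.

Let gT : finGroupType := 'rV['F_2]_s.
Let e (i : 'I_s) : gT := delta_mx 0 i.
Let G : {group gT} := [set: gT]%G.
Let T (i : 'I_s) : {group gT} := <[e i]>%G.
Let z (i : 'I_s) : gT := (\prod_(j in R i) e j)%g.
Let Z (i : 'I_s) : {group gT} := (T i <*> <[z i]>)%G.

Let cfg : tame_config G T Z.
Proof.
have abelG : (2.-abelem G)%g by exact: mx_Fp_abelem.
split=> //.
- by rewrite cardsT card_mx card_Fp // mul1n.
- apply/eqP; rewrite eqEsubset subsetT; apply/subsetP=> v _; rewrite (row_sum_delta v).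
  pose H : {group gT} := <<\bigcup_(i < s) T i>>%G.
  apply: (big_ind (fun w => w \in H)) => [|v1 v2 H1 H2|j _]; [exact: group1 | exact: groupM |].
  have -> : v 0 j *: delta_mx 0 j = (e j ^+ (v 0 j))%g.
    by rewrite FinRing.zmodXgE -[v 0 j in LHS](natr_Zp (v 0 j)) scaler_nat.
  by apply: groupX; apply/mem_gen/bigcupP; exists j => //; exact: cycle_id.
move=> i; split; rewrite ?cycle_cyclic ?subsetT ?joing_subl //.
have nT : <[z i]>%g \subset 'N(T i)%g.
  by rewrite cents_norm // (sub_abelian_cent2 (abelem_abelian abelG)) ?subsetT.
by rewrite quotientYidl // quotient_cyclic // cycle_cyclic.
Qed.

Let supp_e i : supp T (e i) = [set i].
Proof.
apply/eqP; have : supp T (e i) \subset [set i].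
  by rewrite -(mem_inertia cfg) ?in_setT ?cycle_id.
rewrite subset1 => /orP[// | /eqP]; rewrite -(supp1 T) => /(supp_inj cfg (in_setT _) (in_setT _)).
by move/matrixP/(_ 0 i); rewrite !mxE !eqxx => /eqP; rewrite oner_eq0.
Qed.

Lemma tame_config_of_supports :
  exists (gT : finGroupType) (G : {group gT}) (T Z : 'I_s -> {group gT}),
  tame_config G T Z /\ forall i, supp T (zgen T Z i) = R i.
Proof.
exists gT, G, T, Z; split=> // i; have R_D1 := setD1_notin (R_irr i).
have supp_z : supp T (z i) = R i by apply: (supp_prod cfg) => j; rewrite ?in_setT ?supp_e.
have : z i \in Z i by apply: subsetP (joing_subr _ _) _ _; exact: cycle_id.
rewrite (mem_decomp cfg) ?in_setT // supp_z R_D1 => /orP[/eqP R0 | /eqP -> //].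
have Zi : Z i = T i :> {set gT} by rewrite /Z /= /z R0 big_set0 cycle1 joingG1.
have /setIP[] := mem_zgen cfg i; rewrite Zi (mem_inertia cfg) ?in_setT // subset1.
move=> /orP[/eqP zi | /eqP -> //] _.
by have := supp_zgen_notin cfg i; rewrite zi set11.
Qed.

End ConfigurationOfSupports.

(** * Existence and recognition of multiquadratic fields *)

Lemma splitting_number_field_exists (f : {poly rat}) : f != 0 ->
  exists L : splittingFieldType rat,
    galois 1 {:L} /\ splittingFieldFor 1 (map_poly (in_alg L) f) {:L}.
Proof.
move=> nz_f; have [rsC DrsC] := closed_field_poly_normal (map_poly ratr f : {poly algC}).
have [K [KtoC [rs Drs gen_rs]]] := num_field_exists rsC.
have split_f : splittingFieldFor 1 (map_poly (in_alg K) f) {:K}.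
  exists rs => //; rewrite -(eqp_map KtoC) map_prod_XsubC.
  rewrite -(big_map KtoC predT (fun z => 'X - z%:P)) Drs.
  rewrite -map_poly_comp (eq_map_poly (fmorph_eq_rat (KtoC \o in_alg K))) DrsC.
  by rewrite eqp_scale // lead_coef_eq0 map_poly_eq0.
have f_over : map_poly (in_alg K) f \is a polyOver 1%VS.
  by apply/polyOver1P; exists f.
have splitK : splitting_field_axiom K by exists (map_poly (in_alg K) f).
pose splitM := FieldExt_isSplittingField.Build _ K splitK.
pose L : splittingFieldType rat := HB.pack (FieldExt.sort K) splitM.
exists L; split=> //; apply/and3P; split; first exact: sub1v.
  apply/separableP => x _; apply: pcharf0_separable; apply/pcharf0P => n.
  exact: (@natrL_eq0 L).
by apply/splitting_normalField; [exact: sub1v | exists (map_poly (in_alg K) f)].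
Qed.

Lemma multiquadratic_field_exists (I : finType) (d : I -> int) :
  exists (L : splittingFieldType rat) (m : I -> L),
  [/\ galois 1 {:L}, forall i, m i ^+ 2 = (d i)%:~R
    & forall g : gal_of {:L}, (forall i, g (m i) = m i) -> g = 1%g].
Proof.
pose f : {poly rat} := \prod_i ('X^2 - (d i)%:~R%:P).
have nz_f : f != 0.
  by apply/prodf_neq0 => i _; rewrite -size_poly_eq0 size_XnsubC.
have [L [galL [rs Drs gen_rs]]] := splitting_number_field_exists nz_f.
have Df : map_poly (in_alg L) f = \prod_i ('X^2 - (d i)%:~R%:P).
  rewrite rmorph_prod; apply: eq_bigr => i _ /=.
  by rewrite rmorphB /= map_polyXn map_polyC /= -[_%:A]/(in_alg L _) rmorph_int.
have sqrt_exists i : exists m : L, m ^+ 2 = (d i)%:~R.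
  have : ('X^2 - (d i)%:~R%:P : {poly L}) %| \prod_(z <- rs) ('X - z%:P).
    by rewrite -(eqp_dvdr _ Drs) Df (bigD1 i) //= dvdp_mulr.
  case/dvdp_prod_XsubC=> b Db; move: (eqp_size Db); rewrite size_XnsubC //.
  case: (mask b rs) Db => [|m r] Db; first by rewrite big_nil size_poly1.
  exists m; apply/eqP; rewrite -subr_eq0.
  have : root ('X^2 - (d i)%:~R%:P) m by rewrite (eqp_root Db) root_prod_XsubC mem_head.
  by rewrite /root !hornerE.
have [m m2] := fin_all_exists sqrt_exists; exists L, m; split=> // g gm.
apply: (gal_generators_faithful gen_rs) => r rs_r.
have : root (map_poly (in_alg L) f) r by rewrite (eqp_root Drs) root_prod_XsubC.
rewrite Df /root horner_prod => /prodf_eq0[i _]; rewrite !hornerE subr_eq0 -m2 eqf_sqr.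
by case/orP=> /eqP->; rewrite ?rmorphN /= gm.
Qed.

Lemma absz_qstar (p : nat) : `|qstar p|%N = p.
Proof. by rewrite /qstar abszM abszX /= exp1n mul1n. Qed.

Lemma dvdz_qstar (q p : nat) : (q%:Z %| qstar p)%Z = (q %| p)%N.
Proof. by rewrite dvdzE absz_qstar. Qed.

Lemma qstar_mod4 (p : nat) : odd p -> (4%:Z %| 1 - qstar p)%Z.
Proof.
move=> odd_p; have [n Dn] : exists n, p = n.*2.+1.
  by exists p./2; rewrite -[LHS]odd_double_half odd_p.
rewrite /qstar Dn /= doubleK -signr_odd; have := odd_double_half n.
by case: (odd n) => /= Dn2; rewrite ?expr1 ?expr0; lia.
Qed.

Section PrimeDiscriminants.
Variables (I : finType) (p : I -> nat).
Hypotheses (p_inj : injective p) (pr_p : forall i, prime (p i)).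

Lemma squarefree_prod_qstar : squarefree (\prod_j qstar (p j)).
Proof.
move=> q pr_q; rewrite dvdzE abszX (big_morph absz abszM (erefl _)).
under eq_bigr do rewrite absz_qstar.
have [/forallP q'p | /forallPn[i /negPn q_pi]] := boolP [forall j, ~~ (q %| p j)%N].
  apply/negP => /(dvdn_trans (dvdn_mulr q (dvdnn q))).
  by rewrite Euclid_dvd_prod // big_has => /hasP[j _]; apply/negP.
have Dq : q = p i by move: q_pi; rewrite dvdn_prime2 // => /eqP.
rewrite (bigD1 i) //= Dq -mulnn dvdn_pmul2l ?prime_gt0 // Euclid_dvd_prod //.
rewrite big_has_cond; apply/hasPn => j _; apply/negP => /andP[ji].
by rewrite dvdn_prime2 // (inj_eq p_inj) eq_sym (negPf ji).
Qed.

Lemma divisible_discs_qstar i : divisible_discs (qstar \o p) (p i) = [set i].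
Proof. by apply/setP=> j; rewrite !inE /= dvdz_qstar dvdn_prime2 // (inj_eq p_inj) eq_sym. Qed.

Lemma nonresidue_discs_qstar_notin i : i \notin nonresidue_discs (qstar \o p) (p i).
Proof.
rewrite inE /= (_ : (qstar (p i))%:~R = 0) /qchar ?eqxx //.
by apply/eqP; rewrite -(dvdz_pcharf (pchar_Fp (pr_p i))) dvdz_qstar.
Qed.

End PrimeDiscriminants.

(* The Galois group is identified with the subsets of [I], under symmetric difference, in
   such a way that the inertia group of [P i] consists of the subsets of [{i}]. *)
Section AxisInertia.
Variables (L : splittingFieldType rat) (I : finType) (coord : gal_of {:L} -> {set I}).
Implicit Types (g h : gal_of {:L}) (i j k : I) (q : nat) (x : L).
Hypotheses (galL : galois 1 {:L}) (tameL : tamely_ramified L).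
Hypothesis coord_bij : bijective coord.
Hypothesis coordM : {morph coord : g h / (g * h)%g >-> symdiff g h}.
Variables (p : I -> nat) (P : I -> L -> Prop).
Hypothesis pr_p : forall i, prime (p i).
Hypothesis ramified_p : forall q, prime q -> ramified L q -> exists i, q = p i.
Hypothesis overP : forall i, lies_over (P i) (p i).
Hypothesis inertiaP : forall i g, inertia_mem (P i) g <-> coord g \subset [set i].

Lemma tame_axis_inertia_odd i : odd (p i).
Proof.
have [p2 | //] := even_prime (pr_p i).
have [J [DJ]] := tameL (pr_p i) (overP i); case/negP.
have -> : J = coord @^-1: powerset [set i].
  apply/setP=> g; rewrite !inE; apply/idP/idP => [/DJ[_ /inertiaP //] | coord_g].
  by apply/DJ; split; [exact: mem_Gal1 | exact/inertiaP].
by rewrite (on_card_preimset (onW_bij _ coord_bij)) card_powerset cards1 p2.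
Qed.

Lemma axis_reflection_exists k : exists g, coord g = [set k].
Proof. by have [f _ fK] := coord_bij; exists (f [set k]). Qed.

Lemma axis_inertia_negated k x : integral x ->
  (forall g, coord g = [set k] -> g x = - x) -> P k x.
Proof.
move=> ix gx; have [g Dg] := axis_reflection_exists k.
have [_ /(_ x ix)] : inertia_mem (P k) g by apply/inertiaP; rewrite Dg.
rewrite (gx g Dg) -opprD -mulr2n => /(idealN (overP k)); rewrite opprK.
by apply: (ideal_of_double (pr_p k) (overP k)) => //; exact: tame_axis_inertia_odd.
Qed.

Section Discriminants.
Variables (m : I -> L) (d : I -> int).
Hypothesis gal_m : forall j g, g (m j) = (-1) ^+ (j \in coord g) * m j.
Hypothesis m_sqr : forall j, m j ^+ 2 = (d j)%:~R.
Hypothesis sq_d : forall j, squarefree (d j).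

Lemma axis_prime_dvd_disc k : ((p k)%:Z %| d k)%Z.
Proof.
apply/(ideal_intr (pr_p k) (overP k)); rewrite -m_sqr; apply: (ideal_exp (overP k)).
apply: axis_inertia_negated; first exact: integral_sqrt (m_sqr k).
by move=> g Dg; rewrite gal_m Dg set11 mulN1r.
Qed.

(* Otherwise [m j * m k / p k] would be integral and negated by the inertia at [p k],
   although its square is prime to [p k]. *)
Lemma axis_prime_ndvd_disc j k : k != j -> ~~ ((p k)%:Z %| d j)%Z.
Proof.
move=> kj; apply/negP => /dvdzP[a Da]; have /dvdzP[c Dc] := axis_prime_dvd_disc k.
have nz_p := natrL_prime_neq0 L (pr_p k).
pose n := m j * m k / (p k)%:R.
have n2 : n ^+ 2 = (a * c)%:~R.
  rewrite /n expr_div_n exprMn !m_sqr Da Dc !rmorphM /=.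
  by rewrite -[(p k)%:Z%:~R]/((p k)%:R); field.
have : P k n.
  apply: axis_inertia_negated; first exact: integral_sqrt n2.
  move=> g Dg; rewrite /n !rmorphM fmorphV rmorph_nat /= !gal_m Dg set11.
  by rewrite in_set1 eq_sym (negPf kj); ring.
have cofactor_coprime e l : d l = e * (p k)%:Z -> ~~ (p k %| `|e|)%N.
  move=> Dl; have := sq_d l (pr_p k); rewrite Dl expr2; apply: contra => p_e.
  by rewrite dvdz_mul // dvdzE.
move/(ideal_exp (overP k) 1); rewrite n2 => /(ideal_intr (pr_p k) (overP k)).
rewrite dvdzE abszM /= Euclid_dvdM // => /orP[].
  by apply/negP; exact: cofactor_coprime Da.
by apply/negP; exact: cofactor_coprime Dc.
Qed.

Lemma prime_dvd_axis_disc j q : prime q -> (q%:Z %| d j)%Z -> q = p j.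
Proof.
move=> pr_q q_dj; have [k Dq] : exists k, q = p k.
  by apply: ramified_p => //; apply: (ramified_sqrt (m_sqr j)) => //; exact: sq_d.
have [<- // | kj] := eqVneq k j.
by move: q_dj; rewrite Dq (negPf (axis_prime_ndvd_disc kj)).
Qed.

Lemma absz_axis_disc j : `|d j|%N = p j.
Proof.
have /dvdzP[e De] := axis_prime_dvd_disc j; rewrite De abszM /=.
have [-> | ne1] := eqVneq `|e|%N 1%N; first by rewrite mul1n.
have nz_e : e != 0 by apply: contraNneq (squarefree_neq0 (sq_d j)) => e0; rewrite De e0 mul0r.
have pr_q : prime (pdiv `|e|) by rewrite pdiv_prime // ltn_neqAle eq_sym ne1 absz_gt0.
have p_e : ((p j)%:Z %| e)%Z.
  rewrite -(@prime_dvd_axis_disc j (pdiv `|e|)) // ?dvdzE /= ?pdiv_dvd //.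
  by rewrite De abszM dvdn_mulr ?pdiv_dvd.
by have := sq_d j (pr_p j); rewrite De expr2 dvdz_mul.
Qed.

(* With the wrong sign [d j] would be [3] mod [4], and [2] would ramify. *)
Lemma axis_disc_qstar j : d j = qstar (p j).
Proof.
have : d j = qstar (p j) \/ d j = - qstar (p j).
  by have := absz_axis_disc j; have := absz_qstar (p j); lia.
case=> // Dj; have /dvdzP[k Dk] := qstar_mod4 (tame_axis_inertia_odd j).
have /ramified_p : ramified L 2.
  by apply: (@ramified_two_sqrt L (m j) k); rewrite m_sqr Dj; congr _%:~R; lia.
by case=> // i p2; have := tame_axis_inertia_odd i; rewrite -p2.
Qed.

End Discriminants.

Lemma axis_sqrt_qstar_exists : exists m : I -> L,
  (forall j, m j ^+ 2 = (qstar (p j))%:~R) /\ moved m =1 coord.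
Proof.
pose chi j g : int := (-1) ^+ (j \in coord g).
have sqrt_exists j : exists (m : L) (d : int),
    [/\ eigenvector (chi j) m, m ^+ 2 = d%:~R & squarefree d].
  apply: (squarefree_eigenvector_exists galL) => [g h | g]; last by rewrite sqrr_sign.
  by rewrite /chi coordM in_symdiff signr_addb.
have [m /fin_all_exists[d /all_and3[m_eigen m_sqr sq_d]]] := fin_all_exists sqrt_exists.
have gal_m j g : g (m j) = (-1) ^+ (j \in coord g) * m j.
  by rewrite m_eigen /chi rmorph_sign.
exists m; split=> [j | g].
  by rewrite -(axis_disc_qstar gal_m m_sqr sq_d).
apply/setP=> j; rewrite inE gal_m; case: (j \in coord g); last by rewrite mul1r eqxx.
have nz_m : m j != 0 by rewrite -sqrf_eq0 m_sqr intrL_eq0 squarefree_neq0.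
rewrite mulN1r eq_sym -addr_eq0 -mulr2n -mulr_natl mulf_eq0 (negPf nz_m) orbF.
by rewrite natrL_eq0.
Qed.

End AxisInertia.

(** * Realizability and QR matrices *)

Section GaloisCoordinates.
Variables (s : nat) (gT : finGroupType) (G : {group gT}) (T Z : 'I_s -> {group gT}).
Hypothesis cfg : tame_config G T Z.
Variable L : splittingFieldType rat.
Implicit Types g h : gal_of {:L}.

Lemma supp_isom_exists (coord : gal_of {:L} -> {set 'I_s}) :
  bijective coord -> {morph coord : g h / (g * h)%g >-> symdiff g h} ->
  exists phi : {morphism 'Gal({:L} / 1%VS)%g >-> gT},
    isom 'Gal({:L} / 1%VS)%g G phi /\ forall g, supp T (phi g) = coord g.
Proof.
move=> [coord' coordK coord'K] coordM.
have exists_supp g : exists h : gT, h \in G /\ supp T h = coord g.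
  by have [h Gh Dh] := supp_onto cfg (coord g); exists h.
have [f /all_and2[fG fE]] := fin_all_exists exists_supp.
have fM : {in 'Gal({:L} / 1%VS)%g &, {morph f : g h / (g * h)%g}}.
  move=> g h _ _; apply: (supp_inj cfg); rewrite ?groupM //.
  by rewrite (suppM cfg) // !fE coordM.
exists (Morphism fM); split=> //; apply/isomP; split.
  apply/injmP=> g h _ _ /= /(congr1 (supp T)); rewrite !fE.
  exact: can_inj coordK _ _.
apply/setP=> h; apply/morphimP/idP => [[g _ _ ->] | Gh]; first exact: fG.
by exists (coord' (supp T h)); rewrite ?mem_Gal1 //; apply: (supp_inj cfg); rewrite //= fE coord'K.
Qed.

Variable phi : {morphism 'Gal({:L} / 1%VS)%g >-> gT}.
Hypothesis iso_phi : isom 'Gal({:L} / 1%VS)%g G phi.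

Lemma isom_in_group g : phi g \in G.
Proof. by have /isomP[_ <-] := iso_phi; apply: mem_morphim; exact: mem_Gal1. Qed.

Lemma supp_isomM : {morph (fun g => supp T (phi g)) : g h / (g * h)%g >-> symdiff g h}.
Proof. by move=> g h; rewrite /= morphM ?mem_Gal1 // (suppM cfg) ?isom_in_group. Qed.

Lemma supp_isom_bij : bijective (fun g => supp T (phi g)).
Proof.
have /isomP[/injmP phi_inj _] := iso_phi.
apply: inj_card_bij => [g h|].
  move/(supp_inj cfg (isom_in_group g) (isom_in_group h)).
  by apply: phi_inj; exact: mem_Gal1.
rewrite -cardsT -powersetT card_powerset cardsT card_ord.
have [_ <- _ _] := cfg; rewrite -(isom_card iso_phi).
by apply/subset_leq_card/subsetP=> g _; rewrite inE.
Qed.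

End GaloisCoordinates.

Section SignMatrix.
Variables (s : nat) (gT : finGroupType) (G : {group gT}) (T Z : 'I_s -> {group gT}).
Hypothesis cfg : tame_config G T Z.

Lemma sign_matrix_legendreP (p : 'I_s -> nat) :
  injective p -> (forall i, prime (p i)) -> (forall i, odd (p i)) ->
  (forall i j, i != j -> sign_matrix T Z i j = legendre (p i) (p j)) <->
  (forall i, nonresidue_discs (qstar \o p) (p i) = supp T (zgen T Z i)).
Proof.
move=> p_inj pr_p odd_p; have neq_p i j : i != j -> p i != p j by rewrite (inj_eq p_inj).
have legendre_nonresidue i j : i != j ->
    legendre (p i) (p j) = (-1) ^+ (j \in nonresidue_discs (qstar \o p) (p i)).
  move=> ij; rewrite inE /= qchar_qstar ?neq_p //.
  by case: (legendre_cases (pr_p i) (pr_p j) (neq_p i j ij)) => ->.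
split=> [QR i | suppE i j ij]; last first.
  by rewrite sign_matrixE (negPf ij) legendre_nonresidue // suppE.
apply/setP=> j; have [-> | ji] := eqVneq j i.
  by rewrite (negPf (supp_zgen_notin cfg i)) (negPf (nonresidue_discs_qstar_notin pr_p i)).
rewrite eq_sym in ji; apply: (@signr_inj int).
by rewrite -legendre_nonresidue // -QR // sign_matrixE (negPf ji).
Qed.

Lemma realizable_of_QR : QR_matrix (sign_matrix T Z) -> realizable G T Z.
Proof.
case=> p [p_inj p_odd_prime QR].
have pr_p i : prime (p i) by have /andP[] := p_odd_prime i.
have odd_p i : odd (p i) by have /andP[] := p_odd_prime i.
have [L [m [galL m_sqr m_faithful]]] := multiquadratic_field_exists (qstar \o p).
have sq_d : squarefree (\prod_j (qstar \o p) j) := squarefree_prod_qstar p_inj pr_p.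
have d_neq1 j : `|(qstar \o p) j|%N != 1%N by rewrite /= absz_qstar gtn_eqF ?prime_gt1.
have d_mod4 j : (4%:Z %| 1 - (qstar \o p) j)%Z := qstar_mod4 (odd_p j).
have [phi [iso_phi suppE]] := supp_isom_exists cfg
  (moved_bij galL sq_d d_neq1 m_sqr m_faithful) (movedM sq_d m_sqr).
exists L; split=> //; first exact: tame_multiquadratic galL sq_d d_neq1 m_sqr m_faithful d_mod4.
exists phi; split=> //; exists p; split=> // [q pr_q | i].
  rewrite (ramified_multiquadraticP galL sq_d m_sqr m_faithful d_mod4 pr_q).
  split=> -[i q_pi]; exists i; last by rewrite q_pi /= dvdz_qstar.
  by apply/eqP; rewrite -dvdn_prime2 // -dvdz_qstar.
have [P Pi] := prime_over_exists L (pr_p i); exists P; split=> // g _.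
have suppZ := (sign_matrix_legendreP p_inj pr_p odd_p).1 QR i.
have Gphi := isom_in_group iso_phi g.
rewrite (mem_inertia cfg) // (mem_decomp cfg) // suppE -suppZ.
rewrite (inertia_multiquadraticP galL sq_d m_sqr m_faithful d_mod4 (pr_p i) Pi).
rewrite (decomp_multiquadraticP galL sq_d m_sqr m_faithful d_mod4 (pr_p i) Pi (odd_p i)).
rewrite divisible_discs_qstar //; split=> //.
by split=> [/orP[] /eqP | [] ->]; rewrite ?eqxx ?orbT //; [left | right].
Qed.

Lemma QR_of_realizable : realizable G T Z -> QR_matrix (sign_matrix T Z).
Proof.
case=> L [galL tameL [phi [iso_phi [p [p_inj pr_p ram /fin_all_exists[P DP]]]]]].
have overP i : lies_over (P i) (p i) by case: (DP i).
have T_inertia i g : phi g \in T i <-> inertia_mem (P i) g.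
  by case: (DP i) => _ /(_ g (mem_Gal1 g))[].
have Z_decomp i g : phi g \in Z i <-> decomp_mem (P i) g.
  by case: (DP i) => _ /(_ g (mem_Gal1 g))[].
have Gphi := isom_in_group iso_phi.
have coord_bij := supp_isom_bij cfg iso_phi; have coordM := supp_isomM cfg iso_phi.
have ramified_p q : prime q -> ramified L q -> exists i, q = p i by move/ram=> [].
have inertia_coord i g : inertia_mem (P i) g <-> supp T (phi g) \subset [set i].
  by rewrite -T_inertia (mem_inertia cfg).
have odd_p := tame_axis_inertia_odd tameL coord_bij pr_p overP inertia_coord.
have [m [m_sqr movedE]] :=
  axis_sqrt_qstar_exists galL tameL coord_bij coordM pr_p ramified_p overP inertia_coord.
have m_faithful (g : gal_of {:L}) : (forall i, g (m i) = m i) -> g = 1%g.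
  move=> gm; apply: (bij_inj coord_bij); rewrite /= -!movedE moved1.
  by apply/setP=> j; rewrite !inE gm eqxx.
exists p; split=> // [i|]; first by rewrite pr_p odd_p.
apply/(sign_matrix_legendreP p_inj pr_p odd_p) => i; apply/esym.
have sq_d : squarefree (\prod_j (qstar \o p) j) := squarefree_prod_qstar p_inj pr_p.
have d_mod4 j : (4%:Z %| 1 - (qstar \o p) j)%Z := qstar_mod4 (odd_p j).
apply: (supp_zgen_unique cfg) => [|h Gh].
  exact: nonresidue_discs_qstar_notin.
have [g ->] : exists g, h = phi g.
  by move: Gh; have /isomP[_ <-] := iso_phi => /morphimP[g _ _ ->]; exists g.
rewrite Z_decomp -movedE -(divisible_discs_qstar p_inj pr_p).
exact: (decomp_multiquadraticP galL sq_d m_sqr m_faithful d_mod4 (pr_p i) (overP i) (odd_p i)).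
Qed.

End SignMatrix.

Lemma legendre_pair_exists (e f : bool) : exists a b : nat,
  [/\ prime a && odd a, prime b && odd b, a != b,
      legendre a b = (-1) ^+ e & legendre b a = (-1) ^+ f].
Proof.
by case: e f => [] []; [exists 3, 5 | exists 3, 7 | exists 7, 3 | exists 5, 11];
  split=> //; rewrite legendre_has.
Qed.

Lemma QR_matrix_le2 (s : nat) (M : 'I_s -> 'I_s -> int) : (s <= 2)%N ->
  (forall i j, i != j -> exists b : bool, M i j = (-1) ^+ b) -> QR_matrix M.
Proof.
case: s M => [|[|[|//]]] M _ signM.
- by exists (fun=> 3%N); split; case.
- by exists (fun=> 3%N); split=> // i j; rewrite !ord1.
have [[e M01] [f M10]] := (signM ord0 ord_max isT, signM ord_max ord0 isT).
have [a [b [odd_a odd_b neq_ab Lab Lba]]] := legendre_pair_exists e f.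
have ord2 (i : 'I_2) : i = ord0 \/ i = ord_max.
  by case: i => [[|[|//]]] lti; [left | right]; exact: val_inj.
exists (fun i : 'I_2 => if i == ord0 then a else b); split=> [i j | i | i j].
- case: (ord2 i) (ord2 j) => -> [] -> //= /eqP; first by rewrite (negPf neq_ab).
  by rewrite eq_sym (negPf neq_ab).
- by case: ifP.
by case: (ord2 i) (ord2 j) => -> [] -> //= _; rewrite ?M01 ?M10.
Qed.

(* By reciprocity [M i j] differs from [M j i] exactly when both primes are [3] mod [4]. *)
Lemma QR_matrix_asymmetric (s : nat) (M : 'I_s -> 'I_s -> int) (i j k : 'I_s) :
  QR_matrix M -> i != j -> i != k -> j != k ->
  M i j != M j i -> M i k != M k i -> M j k != M k j.
Proof.
case=> p [p_inj p_odd_prime QR] ij ik jk.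
have asymE l n : l != n -> (M l n != M n l) = odd (p l).-1./2 && odd (p n).-1./2.
  move=> ln; have nl : n != l by rewrite eq_sym.
  rewrite (QR l n) // (QR n l) //.
  have /andP[pr_l odd_l] := p_odd_prime l; have /andP[pr_n odd_n] := p_odd_prime n.
  by rewrite legendre_symmetric ?negbK ?(inj_eq p_inj).
by rewrite !asymE // => /andP[_ ->] /andP[_ ->].
Qed.

(* With [z_0] the product of all other [x_j] and [z_i = 1] for [i <> 0], the sign matrix
   is asymmetric at [(0, 1)] and [(0, 2)] but not at [(1, 2)]. *)
Lemma unrealizable_config_exists (s : nat) : (3 <= s)%N ->
  exists (gT : finGroupType) (G : {group gT}) (T Z : 'I_s -> {group gT}),
  tame_config G T Z /\ ~ realizable G T Z.
Proof.
case: s => [|[|[|n]]] // _; pose i0 : 'I_n.+3 := ord0.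
pose i1 : 'I_n.+3 := lift ord0 ord0; pose i2 : 'I_n.+3 := lift ord0 (lift ord0 ord0).
pose R (i : 'I_n.+3) := if i == i0 then [set~ i0] else set0.
have R_irr i : i \notin R i.
  by rewrite /R; case: eqP => [-> | _]; rewrite !inE ?eqxx.
have [gT [G [T [Z [cfg suppE]]]]] := tame_config_of_supports R_irr.
exists gT, G, T, Z; split=> // /(QR_of_realizable cfg) QR.
have := QR_matrix_asymmetric (i := i0) (j := i1) (k := i2) QR isT isT isT.
by rewrite !sign_matrixE !suppE /R !inE => /(_ isT isT).
Qed.

Theorem theorem3p7 :
  (forall (s : nat) (gT : finGroupType) (G : {group gT}) (T Z : 'I_s -> {group gT}),
     (1 <= s)%N -> tame_config G T Z ->
     (realizable G T Z <-> QR_matrix (sign_matrix T Z)))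
  /\ (forall (s : nat) (gT : finGroupType) (G : {group gT}) (T Z : 'I_s -> {group gT}),
     (1 <= s <= 2)%N -> tame_config G T Z -> realizable G T Z)
  /\ (forall s : nat, (3 <= s)%N ->
     exists (gT : finGroupType) (G : {group gT}) (T Z : 'I_s -> {group gT}),
       tame_config G T Z /\ ~ realizable G T Z).
Proof.
split; [|split; last exact: unrealizable_config_exists].
  by move=> s gT G T Z _ cfg; split; [exact: QR_of_realizable | exact: realizable_of_QR].
move=> s gT G T Z /andP[_ s_le2] cfg; apply/(realizable_of_QR cfg)/QR_matrix_le2 => // i j ij.
by exists (j \in supp T (zgen T Z i)); rewrite sign_matrixE (negPf ij).
Qed.
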